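(* Let $g\colon\mathbb{R}^d\to\mathbb{R}$ be $C^2$-smooth with $\beta$-Lipschitz gradient, let $r\colon\mathbb{R}^d\to\mathbb{R}\cup\{+\infty\}$ be closed and $\rho$-weakly convex, and suppose that $f:=g+r$ is bounded from below. Let $\bar x$ be any critical point of $f$ and suppose that $f$ admits a $C^2$ active manifold $\mathcal{M}$ at $\bar x$. Then for any $\mu\in(0,\rho^{-1})$, the proximal-gradient map $$S(x):=\mathrm{prox}_{\mu r}\left(x-\mu\nabla g(x)\right)$$ is $C^1$-smooth on a neighborhood of $\bar x$. Moreover, if $\bar x$ is a strict saddle point of $f$, then the Jacobian $\nabla S(\bar x)$ has a real eigenvalue that is strictly greater than one.
   Context: A function $f\colon\mathbb{R}^d\to\mathbb{R}\cup\{\infty\}$ is closed if its epigraph is closed; it is $\rho$-weakly convex ($\rho>0$) if $x\mapsto f(x)+\frac{\rho}{2}\|x\|^2$ is convex, and weakly convex if it is $\rho$-weakly convex for some $\rho>0$. The proximal map is $\mathrm{prox}_{\mu r}(x)=\mathrm{argmin}_y\{r(y)+\frac1{2\mu}\|y-x\|^2\}$. Subdifferential: if $f(\bar x)$ is finite, $\partial f(\bar x)$ is the set of $v$ with $f(x)\ge f(\bar x)+\langle v,x-\bar x\rangle+o(\|x-\bar x\|)$ as $x\to\bar x$; $\partial f(\bar x)=\emptyset$ if $f(\bar x)=\infty$. A point $\bar x$ is critical for $f$ if $0\in\partial f(\bar x)$. Manifolds: $\mathcal{M}\subset\mathbb{R}^d$ is a $C^p$ manifold of dimension $k$ around $\bar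 x\in\mathcal{M}$ if there are an open neighborhood $U$ of $\bar x$ and a $C^p$ map $G\colon\mathbb{R}^d\to\mathbb{R}^{d-k}$ with $\nabla G(\bar x)$ of full rank and $\mathcal{M}\cap U=\{x\in U:G(x)=0\}$. The tangent space is $T_{\mathcal{M}}(\bar x)=\ker\nabla G(\bar x)$. Active manifold: for a closed weakly convex $f$ with critical point $\bar x$, a set $\mathcal{M}\ni\bar x$ is an active $C^p$ manifold around (at) $\bar x$ if there is a neighborhood $U$ of $\bar x$ such that (smoothness) $\mathcal{M}\cap U$ is a $C^p$-smooth manifold and the restriction of $f$ to $\mathcal{M}\cap U$ is $C^p$-smooth; (sharpness) $\inf\{\|v\|:v\in\partial f(x),\ x\in U\setminus\mathcal{M}\}>0$ (with $\inf\emptyset=+\infty$). Second-order variation: $f_{\mathcal{M}}:=f+\delta_{\mathcal{M}}$, where $\delta_{\mathcal M}$ is $0$ on $\mathcal M$ and $+\infty$ off it. If $\mathcal{M}$ is an active $C^2$ manifold at the critical point $\bar x$ and $u\in T_{\mathcal{M}}(\bar x)$, then $d^2f_{\mathcal{M}}(\bar x)(u)$ denotes the parabolic subderivative $\liminf_{t\searrow0,\,w'\to w}\frac{f_{\mathcal{M}}(\bar x+tu+\frac12t^2w')-f_{\mathcal{M}}(\bar x)}{\frac12t^2}$, whose value is the same for all $w$ for which it is finite. Equivalently, if $F$ is a $C^2$ function agreeing with $f$ on $\mathcal{M}$ near $\bar x$, $G=0$ are local defining equations of $\mathcal{M}$, and $\bar\lambda$ is the unique multiplier with $\nabla F(\bar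 x)+\sum_i\bar\lambda_i\nabla G_i(\bar x)=0$, then $d^2f_{\mathcal{M}}(\bar x)(u)=\langle(\nabla^2F(\bar x)+\sum_i\bar\lambda_i\nabla^2G_i(\bar x))u,u\rangle$. Strict saddle: a critical point $\bar x$ of a weakly convex $f$ is a strict saddle if there is a $C^2$ active manifold $\mathcal{M}$ of $f$ at $\bar x$ and $d^2f_{\mathcal{M}}(\bar x)(u)<0$ for some $u\in T_{\mathcal{M}}(\bar x)$. *)

(* Defs.v *)
From HB Require Import structures.
From mathcomp Require Import all_boot all_order all_algebra.
From mathcomp Require Import all_classical all_reals all_analysis.

Set Implicit Arguments.
Unset Strict Implicit.
Unset Printing Implicit Defensive.

Import Order.TTheory GRing.Theory Num.Theory.
Import numFieldNormedType.Exports.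

Local Open Scope classical_set_scope.
Local Open Scope ring_scope.

Section Euclidean.
Context {R : realType} {d : nat}.
Implicit Types (u v : 'rV[R]_d).

Definition dot u v : R := (u *m v^T) 0 0.

(* The library's norm `|u| on row vectors is the max norm; it induces the same
   topology, but all norms below are Euclidean. *)
Definition enorm u : R := Num.sqrt (dot u u).

Definition gradient (g : 'rV[R]_d -> R) (x : 'rV[R]_d) : 'rV[R]_d :=
  \row_i 'D_(delta_mx 0 i) g x.

End Euclidean.

(* C^p smoothness on U, meant for U open. As the domain is finite-dimensional,
   continuity of all directional derivatives 'D_v f amounts to continuity of
   the differential. *)
Fixpoint Cp_on {R : realType} {d : nat} {W : normedModType R}
    (p : nat) (U : set 'rV[R]_d) (f : 'rV[R]_d -> W) : Prop :=
  if p is p'.+1 then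
    (forall x, U x -> differentiable f x) /\ (forall v, Cp_on p' U ('D_v f))
  else forall x, U x -> {for x, continuous f}.

(* Functions with values in R U {+oo} are maps f : 'rV[R]_d -> \bar R such
   that f x != -oo for all x. *)
Section ExtendedReal.
Context {R : realType} {d : nat}.
Implicit Types (f : 'rV[R]_d -> \bar R) (x u v w : 'rV[R]_d).
Implicit Types (M : set 'rV[R]_d).

Definition epigraph f : set ('rV[R]_d * R) := [set z | (f z.1 <= z.2%:E)%E].

Definition closed_fun f : Prop := closed (epigraph f).

Definition convex_efun f : Prop :=
  forall x y (t : R), 0 <= t <= 1 ->
    (f (t *: x + (1 - t) *: y)%R <= t%:E * f x + (1 - t)%:E * f y)%E.

Definition weakly_convex (rho : R) f : Prop :=
  convex_efun (fun x => f x + (rho / 2 * enorm x ^+ 2)%:E)%E.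

Definition bounded_below f : Prop := exists m : R, forall x, (m%:E <= f x)%E.

(* The one-sided o(|x - xbar|) is spelled out with epsilon. *)
Definition subdifferential f x : set 'rV[R]_d :=
  [set v | f x \is a fin_num /\
    forall eps : R, 0 < eps ->
      \forall y \near x,
        (f x + (dot v (y - x) - eps * enorm (y - x))%:E <= f y)%E].

Definition critical f x : Prop := subdifferential f x 0.

Definition prox_argmin (mu : R) (r : 'rV[R]_d -> \bar R) x : set 'rV[R]_d :=
  [set y | forall z, (r y + ((2 * mu)^-1 * enorm (y - x) ^+ 2)%:E <=
                      r z + ((2 * mu)^-1 * enorm (z - x) ^+ 2)%:E)%E].

(* The argmin is a singleton when r is proper, closed, rho-weakly convex and
   0 < mu < rho^-1; elsewhere the value is unspecified. *)
Definition prox (mu : R) (r : 'rV[R]_d -> \bar R) x : 'rV[R]_d :=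
  get (prox_argmin mu r x).

(* Vectors are rows: 'd G x v = v *m 'J G x, so the d x (d - k) matrix 'J G x is
   the transpose of the usual Jacobian, and surjectivity of the differential
   is row_full. *)
Definition local_equations (p k : nat) M x (U : set 'rV[R]_d)
    (G : 'rV[R]_d -> 'rV[R]_(d - k)) : Prop :=
  [/\ (k <= d)%N, open_nbhs x U, Cp_on p setT G, row_full ('J G x) &
      M `&` U = U `&` [set y | G y = 0]].

Definition Cp_manifold_around (p k : nat) M x : Prop :=
  M x /\ exists U G, @local_equations p k M x U G.

Definition Cp_manifold (p : nat) M : Prop :=
  exists k, forall x, M x -> Cp_manifold_around p k M x.

(* The kernel does not depend on the chosen C^1 local equations. *)
Definition tangent_space M x : set 'rV[R]_d :=
  [set u | exists k U G, @local_equations 1 k M x U G /\ u *m 'J G x = 0].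

Definition Cp_restriction (p : nat) f M : Prop :=
  forall x, M x -> exists V (F : 'rV[R]_d -> R),
    [/\ open_nbhs x V, Cp_on p V F & forall y, (M `&` V) y -> f y = (F y)%:E].

Definition active_manifold (p : nat) f M x : Prop :=
  M x /\ exists U : set 'rV[R]_d,
    [/\ nbhs x U,
        Cp_manifold p (M `&` U),
        Cp_restriction p f (M `&` U) &
        (0 < ereal_inf [set (enorm v)%:E | v in
               [set v | exists2 y, (U `\` M) y & subdifferential f y v]])%E].

Definition restrict_fun f M : 'rV[R]_d -> \bar R :=
  fun x => (f x + (if x \in M then 0 else +oo))%E.

Definition parabolic_subderivative f x u w : \bar R :=
  limf_einf (fun z : R * 'rV[R]_d =>
      (f (x + z.1 *: u + (z.1 ^+ 2 / 2) *: z.2)%R - f x)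
        * ((z.1 ^+ 2 / 2)^-1)%:E)%E
    (filter_prod (0^'+) (nbhs w)).

(* The common value of the parabolic subderivative over all w for which it is
   finite. *)
Definition second_variation f x u : R :=
  get [set c : R | exists w, parabolic_subderivative f x u w = c%:E].

Definition strict_saddle f x : Prop :=
  critical f x /\
  exists2 M, active_manifold 2 f M x &
    exists2 u, tangent_space M x u &
      second_variation (restrict_fun f M) x u < 0.

End ExtendedReal.

(* Main.v *)
Require Import Defs.
From HB Require Import structures.
From mathcomp Require Import all_boot all_order all_algebra.
From mathcomp Require Import all_classical all_reals all_analysis.
From mathcomp Require Import ring lra.

Import Order.TTheory GRing.Theory Num.Theory.
Import numFieldNormedType.Exports.

Local Open Scope classical_set_scope.
Local Open Scope ring_scope.

(* Near [xbar], the point [y = S x] satisfies [v + grad g y \in df(y)] for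
   [v = (x - mu grad g x - y) / mu], and this subgradient tends to [0] as [x -> xbar]; sharpness
   therefore puts [y] on the manifold [{G = 0}].  Since every tangent vector is a limit of
   secants, the subgradient inequality of [r] gives a multiplier [l] with
     y + mu (grad F y - grad g y + l J(y)^T) = x - mu grad g x,   G y = 0,
   where [F] is a C^2 representative of [f] and [J] the Jacobian of [G].  The map [S] is Lipschitz
   because [mu rho < 1], so [y] and [l] depend continuously on [x]; hence only the easy half of
   the implicit function theorem is needed: a continuous solution of a C^1 system is C^1 as soon
   as the block matrix [[I + mu H, J], [mu J^T, 0]] is invertible, [H] being the Hessian of the
   Lagrangian of [F - g].  At [xbar] it is, because weak convexity gives [H >= - rho] on [ker J].
   The differentiated system shows that [S'(xbar) u = s] means [s \in ker J] and
   [<(I + mu H) s, .> = <(I - mu g'') u, .>] on [ker J].  At a strict saddle the second form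
   exceeds the first somewhere on [ker J], so their Rayleigh quotient has a maximum greater than
   one, attained at an eigenvector of [S'(xbar)]. *)

(** * The Euclidean inner product and its comparison with the maximum norm *)

Section DotProduct.
Context {R : realType} {d : nat}.
Implicit Types (u v w : 'rV[R]_d) (a : R).

Lemma dotE u v : dot u v = \sum_i u 0 i * v 0 i.
Proof. by rewrite /dot !mxE; apply: eq_bigr => i _; rewrite !mxE. Qed.

Lemma dotC u v : dot u v = dot v u.
Proof. by rewrite !dotE; apply: eq_bigr => i _; rewrite mulrC. Qed.

Lemma dotDl u v w : dot (u + v) w = dot u w + dot v w.
Proof. by rewrite /dot mulmxDl mxE. Qed.

Lemma dotDr u v w : dot w (u + v) = dot w u + dot w v.
Proof. by rewrite !(dotC w) dotDl. Qed.

Lemma dotNl u v : dot (- u) v = - dot u v.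
Proof. by rewrite /dot mulNmx mxE. Qed.

Lemma dotNr u v : dot u (- v) = - dot u v.
Proof. by rewrite !(dotC u) dotNl. Qed.

Lemma dotBl u v w : dot (u - v) w = dot u w - dot v w.
Proof. by rewrite dotDl dotNl. Qed.

Lemma dotBr u v w : dot w (u - v) = dot w u - dot w v.
Proof. by rewrite dotDr dotNr. Qed.

Lemma dotZl a u v : dot (a *: u) v = a * dot u v.
Proof. by rewrite /dot -scalemxAl mxE. Qed.

Lemma dotZr a u v : dot u (a *: v) = a * dot u v.
Proof. by rewrite !(dotC u) dotZl. Qed.

Lemma dot0l u : dot 0 u = 0.
Proof. by rewrite /dot mul0mx mxE. Qed.

Lemma dot0r u : dot u 0 = 0.
Proof. by rewrite dotC dot0l. Qed.

Lemma dot_delta i u : dot (delta_mx 0 i) u = u 0 i.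
Proof.
rewrite dotE (bigD1 i) //= big1 => [|k ki]; last by rewrite mxE (negPf ki) andbF mul0r.
by rewrite mxE !eqxx mul1r addr0.
Qed.

Lemma dot_ge0 u : 0 <= dot u u.
Proof. by rewrite dotE; apply: sumr_ge0 => i _; rewrite -expr2 sqr_ge0. Qed.

Lemma enorm_sqr u : enorm u ^+ 2 = dot u u.
Proof. by rewrite sqr_sqrtr // dot_ge0. Qed.

Lemma coord_le_norm u i : `|u 0 i| <= `|u|.
Proof.
rewrite [leRHS]/Num.Def.normr /= mx_normrE.
by apply: (le_trans _ (le_bigmax _ _ (0, i))).
Qed.

Lemma norm_sqr_le_dot u : `|u| ^+ 2 <= dot u u.
Proof.
have [u0|/mx_norm_neq0 [[k i] /= E]] := eqVneq (mx_norm u) 0.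
  by rewrite [`|u|]u0 expr0n /= dot_ge0.
rewrite [`|u|]E (ord1 k) dotE (bigD1 i) //= real_normK ?num_real // expr2 lerDl.
by apply: sumr_ge0 => j _; rewrite -expr2 sqr_ge0.
Qed.

Lemma dot_le_norm_sqr u : dot u u <= d%:R * `|u| ^+ 2.
Proof.
rewrite dotE (le_trans (ler_sum _ (G := fun=> `|u| ^+ 2) _)) => //.
  move=> i _; rewrite -expr2 -[u 0 i ^+ 2]real_normK ?num_real // lerXn2r ?nnegrE //.
  exact: coord_le_norm.
by rewrite sumr_const card_ord mulr_natl.
Qed.

Lemma dot_eq0 u : dot u u = 0 -> u = 0.
Proof.
move=> u0; apply/eqP; rewrite -normr_eq0 -[_ == 0]sqrf_eq0 eq_le sqr_ge0 andbT.
by rewrite -u0 norm_sqr_le_dot.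
Qed.

Lemma norm_le_enorm u : `|u| <= enorm u.
Proof.
by rewrite -(ler_pXn2r (_ : 0 < 2)%N) ?nnegrE ?sqrtr_ge0 // enorm_sqr norm_sqr_le_dot.
Qed.

Lemma enorm_le_norm u : enorm u <= d.+1%:R * `|u|.
Proof.
rewrite -(ler_pXn2r (_ : 0 < 2)%N) ?nnegrE ?sqrtr_ge0 ?mulr_ge0 // enorm_sqr.
rewrite (le_trans (dot_le_norm_sqr u)) // exprMn ler_wpM2r ?sqr_ge0 //.
by rewrite -natrX ler_nat expnS expn1 (leq_trans (leqnSn d)) // leq_pmulr.
Qed.

End DotProduct.

Lemma dot_mulmxl {R : realType} {m n : nat} (u : 'rV[R]_m) (A : 'M[R]_(m, n)) v :
  dot (u *m A) v = dot u (v *m A^T).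
Proof. by rewrite /dot trmx_mul trmxK mulmxA. Qed.

(** * Entrywise limits of matrix expressions along a filter *)

Section MatrixLimits.
Context {R : realType} {T : Type} {F : set_system T} {FF : Filter F}.

Lemma cvg_mx {m n : nat} (f : T -> 'M[R]_(m, n)) (l : 'M[R]_(m, n)) :
  (forall i j, f x i j @[x --> F] --> l i j) -> f x @[x --> F] --> l.
Proof.
move=> fl A [P nP /= PA].
have : \forall x \near F, forall ij : 'I_m * 'I_n, P ij.1 ij.2 (f x ij.1 ij.2).
  by apply: filter_forall => -[i j]; apply: fl; apply: nP.
by apply: filterS => x Px; apply: PA => i j; apply: (Px (i, j)).
Qed.

Lemma cvg_coord {m n : nat} {f : T -> 'M[R]_(m, n)} {l : 'M[R]_(m, n)} i j :
  f x @[x --> F] --> l -> f x i j @[x --> F] --> l i j.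
Proof.
move=> fl; apply: (cvg_comp f (fun N : 'M[R]_(m, n) => N i j) fl).
exact: coord_continuous.
Qed.

Lemma cvg_matrix_of_fun {m n : nat} (e : T -> 'I_m -> 'I_n -> R) (e0 : 'I_m -> 'I_n -> R) :
  (forall i j, e x i j @[x --> F] --> e0 i j) ->
  \matrix_(i, j) e x i j @[x --> F] --> (\matrix_(i, j) e0 i j : 'M[R]_(m, n)).
Proof.
move=> ee; apply: cvg_mx => i j; rewrite mxE; under eq_cvg => x do rewrite mxE.
exact: ee.
Qed.

Lemma cvg_mulmx {m n p : nat} {f : T -> 'M[R]_(m, n)} {g : T -> 'M[R]_(n, p)}
    {a : 'M[R]_(m, n)} {b : 'M[R]_(n, p)} :
  f x @[x --> F] --> a -> g x @[x --> F] --> b ->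
  f x *m g x @[x --> F] --> a *m b.
Proof.
move=> fa gb; apply: cvg_mx => i j; rewrite mxE.
under eq_cvg => x do rewrite mxE.
apply: cvg_big => [|k _]; first exact: add_continuous.
exact: cvgM (cvg_coord _ _ fa) (cvg_coord _ _ gb).
Qed.

Lemma cvg_trmx {m n : nat} {f : T -> 'M[R]_(m, n)} {a : 'M[R]_(m, n)} :
  f x @[x --> F] --> a -> (f x)^T @[x --> F] --> a^T.
Proof.
move=> fa; apply: cvg_mx => i j; rewrite mxE.
by under eq_cvg => x do rewrite mxE; apply: cvg_coord.
Qed.

Lemma cvg_lsubmx {m n1 n2 : nat} {f : T -> 'M[R]_(m, n1 + n2)} {a : 'M[R]_(m, n1 + n2)} :
  f x @[x --> F] --> a -> lsubmx (f x) @[x --> F] --> lsubmx a.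
Proof.
move=> fa; apply: cvg_mx => i j; rewrite mxE.
by under eq_cvg => x do rewrite mxE; apply: cvg_coord.
Qed.

Lemma cvg_dot {d : nat} {f g : T -> 'rV[R]_d} {a b : 'rV[R]_d} :
  f x @[x --> F] --> a -> g x @[x --> F] --> b ->
  dot (f x) (g x) @[x --> F] --> dot a b.
Proof. by move=> fa gb; apply: cvg_coord; apply: cvg_mulmx => //; apply: cvg_trmx. Qed.

Lemma cvg_block_mx {m1 m2 n1 n2 : nat} {f1 : T -> 'M[R]_(m1, n1)}
    {f2 : T -> 'M[R]_(m1, n2)} {f3 : T -> 'M[R]_(m2, n1)} {f4 : T -> 'M[R]_(m2, n2)}
    {a1 : 'M[R]_(m1, n1)} {a2 : 'M[R]_(m1, n2)}
    {a3 : 'M[R]_(m2, n1)} {a4 : 'M[R]_(m2, n2)} :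
  f1 x @[x --> F] --> a1 -> f2 x @[x --> F] --> a2 ->
  f3 x @[x --> F] --> a3 -> f4 x @[x --> F] --> a4 ->
  block_mx (f1 x) (f2 x) (f3 x) (f4 x) @[x --> F] --> block_mx a1 a2 a3 a4.
Proof.
move=> c1 c2 c3 c4; apply: cvg_mx => i j.
case: (split_ordP i) => k ->; case: (split_ordP j) => l ->;
  under eq_cvg => x do rewrite ?(block_mxEul, block_mxEur, block_mxEdl, block_mxEdr);
  rewrite ?(block_mxEul, block_mxEur, block_mxEdl, block_mxEdr);
  exact: cvg_coord.
Qed.

(** The sign is only required frequently, not eventually: the inequalities below hold at points of
    the manifold, which meet every set of the filter without forming one. *)
Lemma cvg_frequently_ge0 (f : T -> R) (l : R) : f x @[x --> F] --> l ->
  (forall V, F V -> exists2 x, V x & 0 <= f x) -> 0 <= l.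
Proof.
move=> fl freq; rewrite leNgt; apply/negP => l0.
have [x /= fx0] := freq _ (fl _ (lt_nbhsl l0)).
by rewrite leNgt fx0.
Qed.

Lemma cvg_frequently_eq0 {m n : nat} (f : T -> 'M[R]_(m, n)) (l : 'M[R]_(m, n)) :
  f x @[x --> F] --> l ->
  (forall V, F V -> exists2 x, V x & f x = 0) -> l = 0.
Proof.
move=> fl freq; apply/matrixP => i j; rewrite mxE.
have cij := cvg_coord i j fl.
apply/eqP; rewrite eq_le -[_ <= 0]oppr_ge0; apply/andP; split.
  apply: (cvg_frequently_ge0 _ _ (cvgN cij)) => V /freq [x Vx fx]; exists x => //.
  by rewrite /= fx mxE oppr0.
apply: (cvg_frequently_ge0 _ _ cij) => V /freq [x Vx fx]; exists x => //.
by rewrite fx mxE.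
Qed.

End MatrixLimits.

(** * First- and second-order calculus *)

Lemma norm_mulmx_le {R : realType} {m n p : nat} (A : 'M[R]_(m, n)) (B : 'M[R]_(n, p)) :
  `|A *m B| <= n%:R * `|A| * `|B|.
Proof.
have le_mx k l (C : 'M[R]_(k, l)) i j : `|C i j| <= `|C|.
  rewrite [leRHS]/Num.Def.normr /= mx_normrE.
  by apply: (le_trans _ (le_bigmax _ _ (i, j))).
rewrite [leLHS]/Num.Def.normr /= mx_normrE bigmax_le ?mulr_ge0 // => -[i j] _ /=.
rewrite mxE (le_trans (ler_norm_sum _ _ _)) //.
rewrite (le_trans (ler_sum _ (G := fun=> `|A| * `|B|) _)) // => [k _|].
  by rewrite normrM ler_pM.
by rewrite sumr_const card_ord -mulrA mulr_natl.
Qed.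

Section Slopes.
Context {R : realType} {d : nat}.
Implicit Types (f : 'rV[R]_d -> R) (a x v : 'rV[R]_d).

Lemma derive_gradient f a v :
  differentiable f a -> 'D_v f a = dot v (gradient f a).
Proof.
move=> df; rewrite deriveE // {1}(row_sum_delta v) linear_sum dotE.
by apply: eq_bigr => i _; rewrite linearZ /= mxE deriveE.
Qed.

(* Caratheodory's form of differentiability: since the slope is exact for every [x] and
   continuous at [a], implicit differentiation reduces to limits of matrix equations. *)
Lemma gradient_slope f a : differentiable f a ->
  exists q : 'rV[R]_d -> 'rV[R]_d,
    [/\ q x @[x --> a] --> gradient f a, q a = gradient f a &
        forall x, f x = f a + dot (x - a) (q x)].
Proof.
move=> df; set G := gradient f a.
pose e x := (f x - f a - dot (x - a) G) / dot (x - a) (x - a).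
exists (fun x => G + e x *: (x - a)); split.
- rewrite -[X in _ --> X]addr0; apply: (@cvgD _ _ _ (nbhs a) _ (fun=> G)); first exact: cvg_cst.
  apply/cvgr0Pnorm_le => eps eps0.
  have /eqaddoP/(_ _ eps0) := diff_locally df.
  rewrite [\forall x \near _, _ <= _](near_shift a) sub0r; apply: filterS => x /=.
  rewrite /cst /= !fctE /= subrK -deriveE // derive_gradient // -/G => le1.
  have [->|xa] := eqVneq (x - a) 0; first by rewrite scaler0 normr0 ltW.
  have n0 : 0 < `|x - a| by rewrite normr_gt0.
  have d0 : 0 < dot (x - a) (x - a).
    by rewrite (lt_le_trans _ (norm_sqr_le_dot _)) // exprn_gt0.
  rewrite normrZ normrM normfV (gtr0_norm d0) mulrAC ler_pdivrMr //.
  rewrite (le_trans (ler_wpM2r (ltW n0) (_ : _ <= eps * `|x - a|))) //.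
    by apply: le_trans le1; rewrite opprD addrA.
  by rewrite -mulrA -expr2 ler_wpM2l ?norm_sqr_le_dot // ltW.
- by rewrite subrr scaler0 addr0.
move=> x; rewrite dotDr dotZr.
have [E|xa] := eqVneq (dot (x - a) (x - a)) 0.
  by rewrite E mulr0 addr0 -{1}[x](subrK a) (dot_eq0 _ E) dot0l add0r addr0.
rewrite /e divfK //; ring.
Qed.

(** The converse of [gradient_slope] for vector values: an exact secant identity near [a] whose
    slope converges leaves the remainder [(x - a) *m (Q x - J)], which is [o(x - a)]. *)
Lemma slope_diff {n : nat} (F : 'rV[R]_d -> 'rV[R]_n) a
    (Q : 'rV[R]_d -> 'M[R]_(d, n)) (J : 'M[R]_(d, n)) :
  (\forall x \near a, F x = F a + (x - a) *m Q x) -> Q x @[x --> a] --> J ->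
  differentiable F a /\ 'J F a = J.
Proof.
move=> FQ QJ; pose df := mulmxr J : {linear 'rV[R]_d -> 'rV[R]_n}.
have df_cont : continuous df.
  by move=> v; apply: (cvg_mulmx (F := nbhs v)); [exact: cvg_id|exact: cvg_cst].
have dfE : F \o shift a = cst (F a) + df +o_ (0 : 'rV[R]_d) id.
  apply/eqaddoP => eps eps0.
  rewrite [\forall x \near _, _ <= _](near_shift a) sub0r.
  have c0 : 0 < eps / d.+1%:R by rewrite divr_gt0.
  move/cvgrPdist_le: QJ => /(_ _ c0) QJ.
  near=> x; rewrite /cst /= !fctE /= subrK.
  have -> : F x = F a + (x - a) *m Q x by near: x.
  rewrite opprD addrACA subrr add0r -mulmxBr.
  rewrite (le_trans (norm_mulmx_le _ _)) // mulrAC ler_wpM2r //.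
  rewrite (le_trans (ler_wpM2l (ler0n _ _) (_ : _ <= eps / d.+1%:R))) //.
    by rewrite distrC; near: x.
  by rewrite mulrCA ler_piMr ?(ltW eps0) // ler_pdivrMr ?mul1r ?ler_nat.
have dE : 'd F a = df :> (_ -> _) by apply: diff_unique.
split; last first.
  by apply/row_matrixP => i; rewrite !rowE /jacobian mul_rV_lin1 dE.
by apply/diff_locallyP; rewrite dE.
Unshelve. all: by end_near. Qed.

End Slopes.

(** The row index carries the outer derivative, so that [s *m hessian h x] is the derivative of the
    gradient along the row vector [s] even before symmetry is known. *)
Definition hessian {R : realType} {d : nat} (h : 'rV[R]_d -> R) (x : 'rV[R]_d) : 'M[R]_d :=
  \matrix_(i, j) 'D_(delta_mx 0 i) ('D_(delta_mx 0 j) h) x.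

(** Meant for intermediate points from mean value theorems: their parameter [t] is chosen
    arbitrarily and is merely bounded. *)
Lemma cvg_scale_bounded {R : realType} {V : normedModType R} {T : Type}
    {F : set_system T} {FF : Filter F} (t : T -> R) (f : T -> V) :
  (forall x, `|t x| <= 1) -> f x @[x --> F] --> (0 : V) ->
  t x *: f x @[x --> F] --> (0 : V).
Proof.
move=> t1 /cvgr0Pnorm_le f0; apply/cvgr0Pnorm_le => e e0.
near=> x; rewrite normrZ.
have fe : `|f x| <= e by near: x; apply: f0.
by rewrite (le_trans _ fe) // ler_piMl.
Unshelve. all: by end_near. Qed.

(** * Second-order Taylor expansion and symmetry of the Hessian *)

Section SecondOrder.
Context {R : realType} {d : nat}.
Variables (h : 'rV[R]_d -> R) (V : set 'rV[R]_d) (a : 'rV[R]_d).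
Hypotheses (aV : open_nbhs a V) (h2 : Cp_on 2 V h).

Let Va : V a. Proof. by case: aV. Qed.

Lemma gradient_matrix_slope : exists Q : 'rV[R]_d -> 'M[R]_d,
  [/\ Q x @[x --> a] --> hessian h a, Q a = hessian h a &
      forall x, gradient h x = gradient h a + (x - a) *m Q x].
Proof.
have dDh j := (h2.2 (delta_mx 0 j)).1 a Va.
have /choice [q qP] j := gradient_slope _ _ (dDh j).
exists (fun x => \matrix_(i, j) q j x 0 i); split.
- apply: (cvg_matrix_of_fun (F := nbhs a)) => i j.
  by have [/(cvg_coord 0 i) + _ _] := qP j; rewrite mxE.
- by apply/matrixP => i j; rewrite !mxE; have [_ -> _] := qP j; rewrite mxE.
move=> x; apply/rowP => j; rewrite !mxE; have [_ _ ->] := qP j.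
by rewrite dotE; congr (_ + _); apply: eq_bigr => i _; rewrite !mxE.
Qed.

Lemma gradient_continuous : gradient h x @[x --> a] --> gradient h a.
Proof.
apply: (cvg_matrix_of_fun (F := nbhs a)) => i j.
apply: (differentiable_continuous (x := a)).
exact: (h2.2 (delta_mx 0 j)).1.
Qed.

Lemma hessian_continuous : hessian h x @[x --> a] --> hessian h a.
Proof.
apply: (cvg_matrix_of_fun (F := nbhs a)) => i j.
exact: ((h2.2 (delta_mx 0 j)).2 (delta_mx 0 i)).
Qed.

Lemma is_derive_line (x v : 'rV[R]_d) (t : R) : V (x + t *: v) ->
  is_derive t 1 (fun t => h (x + t *: v)) (dot v (gradient h (x + t *: v))).
Proof.
move=> Vx; have dh := h2.1 _ Vx.
have E : (fun s : R => s^-1 *: (((fun t => h (x + t *: v)) \o shift t) (s *: 1) - h (x + t *: v)))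
   = (fun s => s^-1 *: ((h \o shift (x + t *: v)) (s *: v) - h (x + t *: v))).
  apply/funext => s /=; congr (_ *: (h _ - _)).
  by rewrite scalerDl [s *: 1]mulr1 addrCA.
apply: DeriveDef.
  by rewrite /derivable E; exact: diff_derivable.
by rewrite /derive E -derive_gradient.
Qed.

Lemma line_in_ball (e : R) (x v : 'rV[R]_d) (t : R) :
  `|x - a| + `|v| < e -> ball a e `<=` V -> 0 <= t <= 1 -> V (x + t *: v).
Proof.
move=> xve eV /andP[t0 t1]; apply: eV; rewrite -ball_normE /= distrC addrAC.
rewrite (le_lt_trans (ler_normD _ _)) // (le_lt_trans _ xve) // lerD2l normrZ.
by rewrite ger0_norm // ler_piMl.
Qed.

(** Rolle's theorem on the segment from [a] to [x] finds an intermediate point at which half the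
    slope of the gradient makes the expansion exact; that point tends to [a] with [x]. *)
Lemma taylor2_slope : exists Q : 'rV[R]_d -> 'M[R]_d,
  Q x @[x --> a] --> 2^-1 *: hessian h a /\
  \forall x \near a, h x = h a + dot (x - a) (gradient h a) + dot ((x - a) *m Q x) (x - a).
Proof.
have [Q [Qa _ gradQ]] := gradient_matrix_slope.
have /nbhs_ballP [e /= e0 eV] := open_nbhs_nbhs aV.
have /choice [t tP] (x : 'rV[R]_d) : exists t : R, 0 <= t <= 1 /\ (`|x - a| < e ->
    h x = h a + dot (x - a) (gradient h a) +
          dot ((x - a) *m (2^-1 *: Q (a + t *: (x - a)))) (x - a)).
  have [xe|xe] := ltP (`|x - a|) e; last by exists 0; split=> //; rewrite lexx ler01.
  set v := x - a; set k := dot v (gradient h a).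
  (* With this [c] the function [phi] takes the value [h a] at both [0] and [1]; a zero [s] of its
     derivative gives [2 * c] as the quadratic form of [Q] at [a + s *: v]. *)
  pose c := h x - h a - k.
  pose phi : R -> R := (fun t => h (a + t *: v)) - (k \*: id) - (c \*: (id ^+ 2)).
  have phiE t : phi t = h (a + t *: v) - k * t - c * t ^+ 2.
    by rewrite /phi !fctE.
  have dphi (t : R) : 0 <= t <= 1 ->
      is_derive t 1 phi (dot v (gradient h (a + t *: v)) - k - 2 * t * c).
    move=> t01; have Vt : V (a + t *: v).
      by apply: (line_in_ball e) => //; rewrite subrr normr0 add0r.
    have dh := is_derive_line a v t Vt.
    apply: is_derive_eq; rewrite /= !/(_ *: _) /=; ring.
  have [|||s s01 ds] := @Rolle R phi 0 1 ltr01.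
  - by move=> t; rewrite in_itv /= => /andP[t0 t1]; have [] := dphi t; rewrite ?(ltW t0) ?(ltW t1).
  - by apply: derivable_within_continuous => t; rewrite in_itv /= => /dphi [].
  - by rewrite !phiE scale0r scale1r addr0 [a + v]addrC subrK /c; ring.
  have /andP[s0 s1] : 0 < s < 1 by move: s01; rewrite in_itv.
  have s01' : 0 <= s <= 1 by rewrite !ltW.
  exists s; split=> // _.
  have gs : gradient h (a + s *: v) = gradient h a + s *: (v *m Q (a + s *: v)).
    by rewrite gradQ addrAC subrr add0r -scalemxAl.
  have [_ Ds] := dphi _ s01'; move: ds => [_]; rewrite Ds gs dotDr dotZr -/k => E0.
  have cE : dot v (v *m Q (a + s *: v)) = 2 * c.
    by apply: (mulfI (lt0r_neq0 s0)); apply: subr0_eq; rewrite -[RHS]E0; ring.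
  by rewrite -scalemxAr dotZl [dot (v *m _) v]dotC cE mulKf ?pnatr_eq0 // /c /k; ring.
exists (fun x => 2^-1 *: Q (a + t x *: (x - a))); split.
  apply: (@cvgZl_tmp _ _ _ (nbhs a)).
  suff za : a + t x *: (x - a) @[x --> a] --> a by exact: (cvg_comp _ _ za Qa).
  rewrite -[X in _ --> X]addr0; apply: (@cvgD _ _ _ (nbhs a) _ (fun=> a)).
    exact: cvg_cst.
  apply: (cvg_scale_bounded (F := nbhs a)).
    by move=> x; have [/andP[t0 t1] _] := tP x; rewrite ger0_norm.
  rewrite -(subrr a); apply: (@cvgB _ _ _ (nbhs a) _ id (fun=> a)).
    exact: cvg_id.
  exact: cvg_cst.
near=> x; apply: (tP x).2.
by rewrite distrC; near: x; move: (nbhsx_ballx a e e0); rewrite -ball_normE.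
Unshelve. all: by end_near. Qed.

(* The left-hand side is symmetric in [s] and [s'], whence the symmetry of the Hessian. *)
Lemma second_difference_cvg (s s' : 'rV[R]_d) :
  (h (a + t *: s + t *: s') - h (a + t *: s) - h (a + t *: s') + h a) / t ^+ 2
    @[t --> (0 : R)^'] --> dot s' (s *m hessian h a).
Proof.
have [Q [Qa _ gradQ]] := gradient_matrix_slope.
have /nbhs_ballP [e /= e0 eV] := open_nbhs_nbhs aV.
(* The mean value theorem for [psi] below gives a difference of gradients at two points. Expanding
   both about [a] and dividing by [t] leaves [K], whose second summand vanishes in the limit because
   both values of [Q] tend to the Hessian. *)
pose K (t c : R) := s *m Q (a + t *: s + c *: (t *: s')) +
  c *: (s' *m (Q (a + t *: s + c *: (t *: s')) - Q (a + c *: (t *: s')))).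
have /choice [c cP] (t : R) : exists c : R, 0 <= c <= 1 /\
    (`|t| * (`|s| + `|s'|) < e ->
     h (a + t *: s + t *: s') - h (a + t *: s) - h (a + t *: s') + h a =
     t ^+ 2 * dot s' (K t c)).
  have [te|te] := ltP (`|t| * (`|s| + `|s'|)) e; last first.
    by exists 0; split=> //; rewrite lexx ler01.
  rewrite mulrDr in te.
  have te1 : `|a + t *: s - a| + `|t *: s'| < e by rewrite addrAC subrr add0r !normrZ.
  have te2 : `|a - a| + `|t *: s'| < e.
    by rewrite subrr normr0 add0r normrZ (le_lt_trans _ te) // lerDr mulr_ge0.
  pose psi : R -> R := (fun c => h (a + t *: s + c *: (t *: s'))) -
                       (fun c => h (a + c *: (t *: s'))).
  pose dp (c : R) := dot (t *: s') (gradient h (a + t *: s + c *: (t *: s'))) -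
                     dot (t *: s') (gradient h (a + c *: (t *: s'))).
  have dpsi (c : R) : 0 <= c <= 1 -> is_derive c 1 psi (dp c).
    move=> c01.
    have V1 := line_in_ball e _ _ _ te1 eV c01.
    have V2 := line_in_ball e _ _ _ te2 eV c01.
    exact: is_deriveB (is_derive_line _ _ _ V1) (is_derive_line _ _ _ V2).
  have [||c c01 E] := @MVT R psi dp 0 1 ltr01.
  - by move=> x; rewrite in_itv /= => /andP[x0 x1]; apply: dpsi; rewrite !ltW.
  - by apply: derivable_within_continuous => x; rewrite in_itv /= => /dpsi [].
  exists c; split=> [|_].
    by move: c01; rewrite in_itv /= => /andP[/ltW -> /ltW ->].
  move: E; rewrite /psi /dp !fctE !scale1r !scale0r !addr0 subr0 mulr1 => E.
  transitivity (h (a + t *: s + t *: s') - h (a + t *: s') - (h (a + t *: s) - h a)).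
    by ring.
  rewrite E -dotBr dotZl expr2 -mulrA; congr (t * _); rewrite -dotZr; congr (dot s' _).
  rewrite [in LHS]gradQ [gradient h (a + c *: _)]gradQ /K.
  rewrite opprD addrACA subrr add0r.
  have -> : a + t *: s + c *: (t *: s') - a = t *: s + c *: (t *: s').
    by rewrite addrAC [a + _]addrC addrK.
  rewrite [a + c *: _ - a]addrAC subrr add0r mulmxDl mulmxBr.
  by rewrite scalerDr scalerBr !scalerBr -!scalemxAl !scalerA [c * t]mulrC addrA.
have tau1 t : `|c t| <= 1 by have [/andP[t0 t1] _] := cP t; rewrite ger0_norm.
have cvgt (v : 'rV[R]_d) : t *: v @[t --> (0 : R)^'] --> (0 : 'rV[R]_d).
  rewrite -(scale0r v); apply: (@cvgZr_tmp _ _ _ (0^')).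
  exact: cvg_within.
have cvgct (v : 'rV[R]_d) : c t *: (t *: v) @[t --> (0 : R)^'] --> (0 : 'rV[R]_d).
  exact: (cvg_scale_bounded (F := 0^')).
have z1 : a + t *: s + c t *: (t *: s') @[t --> (0 : R)^'] --> a.
  rewrite -[X in _ --> X]addr0; apply: (@cvgD _ _ _ (0^')) => //.
  rewrite -[X in _ --> X]addr0; apply: (@cvgD _ _ _ (0^') _ (fun=> a)) => //.
  exact: cvg_cst.
have z2 : a + c t *: (t *: s') @[t --> (0 : R)^'] --> a.
  rewrite -[X in _ --> X]addr0.
  by apply: (@cvgD _ _ _ (0^') _ (fun=> a)) => //; exact: cvg_cst.
have Kc : K t (c t) @[t --> (0 : R)^'] --> s *m hessian h a.
  rewrite -[X in _ --> X]addr0; apply: (@cvgD _ _ _ (0^')).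
    apply: (cvg_mulmx (F := 0^')); first exact: cvg_cst.
    exact: cvg_comp z1 Qa.
  apply: (cvg_scale_bounded (F := 0^')) => //.
  rewrite -(mulmx0 _ s') -[X in _ *m X](subrr (hessian h a)).
  apply: (cvg_mulmx (F := 0^')); first exact: cvg_cst.
  by apply: (@cvgB _ _ _ (0^')); [exact: cvg_comp z1 Qa|exact: cvg_comp z2 Qa].
have : dot s' (K t (c t)) @[t --> (0 : R)^'] --> dot s' (s *m hessian h a).
  by apply: (cvg_dot (F := 0^')) => //; exact: cvg_cst.
apply: cvg_trans; apply: near_eq_cvg; near=> t.
have t0 : t != 0 by near: t; exact: nbhs_dnbhs_neq.
have [_ ->] := cP t; first by rewrite mulrC mulKf // expf_neq0.
near: t.
have : `|t| * (`|s| + `|s'|) @[t --> (0 : R)^'] --> `|0 : R| * (`|s| + `|s'|).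
  by apply: cvgM; [apply: cvg_norm; exact: cvg_within|exact: cvg_cst].
by rewrite normr0 mul0r => /cvgr_lt; apply.
Unshelve. all: by end_near. Qed.

Lemma hessian_sym : (hessian h a)^T = hessian h a.
Proof.
have E (s s' : 'rV[R]_d) : dot s' (s *m hessian h a) = dot s (s' *m hessian h a).
  have := second_difference_cvg s s'; have := second_difference_cvg s' s.
  under eq_cvg => t.
    rewrite [a + _ + _]addrAC [h _ - _ - _]addrAC; over.
  by move=> c1 c2; apply: (cvg_unique _ c2 c1).
apply/matrixP => i j; rewrite mxE.
have := E (delta_mx 0 j) (delta_mx 0 i).
by rewrite -!rowE !dot_delta [LHS]mxE [RHS]mxE.
Qed.

End SecondOrder.

(** * Perturbation of matrix equations and generalized eigenvectors *)

Section MatrixPerturbation.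
Context {R : realType} {T : Type} {F : set_system T} {FF : Filter F} {n p : nat}.
Variables (A : T -> 'M[R]_(n, p)) (A0 : 'M[R]_(n, p)).
Hypotheses (AA0 : A x @[x --> F] --> A0) (A0free : row_free A0).

(* [D] solves the fixed-point equation [D = B - D *m (A x - A0) *m A0^+], whose
   linear part is a contraction once [A x] is close to [A0]. *)
Let near_contraction : \forall x \near F, forall k (D B : 'M[R]_(k, n)),
  D = B - D *m ((A x - A0) *m pinvmx A0) -> `|D| <= 2 * `|B|.
Proof.
have E0 : (A x - A0) *m pinvmx A0 @[x --> F] --> (0 : 'M[R]_n).
  rewrite -(mul0mx _ (pinvmx A0)) -(subrr A0).
  apply: cvg_mulmx; last exact: cvg_cst.
  by apply: cvgB => //; exact: cvg_cst.
(* [norm_mulmx_le] costs a factor [n], so this bound makes the contraction factor at most [1/2]; the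
   successor covers [n = 0]. *)
have c0 : 0 < (2 * n.+1%:R)^-1 :> R by rewrite invr_gt0 mulr_gt0 // ltr0n.
move/cvgr0Pnorm_le: E0 => /(_ _ c0); apply: filterS => x Ex k D B DE.
suff DD : `|D *m ((A x - A0) *m pinvmx A0)| <= 2^-1 * `|D|.
  have : `|D| <= `|B| + 2^-1 * `|D|.
    by rewrite {1}DE (le_trans (ler_normB _ _)) // lerD2l.
  lra.
rewrite (le_trans (norm_mulmx_le _ _)) // mulrAC ler_wpM2r //.
rewrite (le_trans (ler_wpM2l (ler0n _ _) Ex)) // invfM mulrCA ler_piMr //.
by rewrite ler_pdivrMr ?mul1r ?ler_nat // ltr0n.
Qed.

(** A row [v] killed by [A x] solves the fixed-point equation with [B = 0], hence vanishes. *)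
Lemma near_row_free : \forall x \near F, row_free (A x).
Proof.
apply: filterS near_contraction => x contr.
apply: inj_row_free => v vA0.
apply/eqP; rewrite -normr_le0 -(mulr0 2) -(normr0 'M[R]_(1, n)); apply: contr.
by rewrite sub0r mulmxA mulmxBr vA0 sub0r mulNmx opprK -mulmxA mulmxVp // mulmx1.
Qed.

(** Solutions of linear systems depend continuously on the data. Only the pseudoinverse of the limit
    [A0] enters, so continuity of [pinvmx] or [invmx] is never invoked; multipliers and inverse
    matrices are both handled this way. *)
Lemma cvg_left_division {k : nat} (L : T -> 'M[R]_(k, n)) (q : T -> 'M[R]_(k, p)) L0 :
  (\forall x \near F, L x *m A x = q x) -> q x @[x --> F] --> L0 *m A0 ->
  L x @[x --> F] --> L0.
Proof.
move=> LA q0.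
(* The inhomogeneous term for which [D = L x - L0] satisfies the fixed-point equation. *)
pose B x := (q x - L0 *m A0 - L0 *m (A x - A0)) *m pinvmx A0.
have B0 : B x @[x --> F] --> (0 : 'M[R]_(k, n)).
  rewrite -(mul0mx _ (pinvmx A0)); apply: cvg_mulmx; last exact: cvg_cst.
  have -> : 0 = (L0 *m A0 - L0 *m A0) - L0 *m (A0 - A0) :> 'M[R]_(k, p).
    by rewrite !subrr mulmx0 subrr.
  apply: cvgB; first by apply: cvgB => //; exact: cvg_cst.
  apply: cvg_mulmx; first exact: cvg_cst.
  by apply: cvgB => //; exact: cvg_cst.
apply/cvgrPdist_le => e e0.
have e2 : 0 < e / 2 by rewrite divr_gt0.
move/cvgr0Pnorm_le: B0 => /(_ _ e2) B0.
near=> x.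
have Bx : `|B x| <= e / 2 by near: x.
have contr : forall k (D B : 'M[R]_(k, n)),
  D = B - D *m ((A x - A0) *m pinvmx A0) -> `|D| <= 2 * `|B| by near: x.
have Lx : L x *m A x = q x by near: x.
rewrite distrC (le_trans (contr _ _ (B x) _)) //; last by rewrite mulrC -ler_pdivlMr.
rewrite mulmxA -mulmxBl -Lx.
have -> : L x *m A x - L0 *m A0 - L0 *m (A x - A0) - (L x - L0) *m (A x - A0)
    = (L x - L0) *m A0.
  rewrite -addrA -opprD -mulmxDl [L0 + _]addrC subrK mulmxBr.
  by rewrite opprB addrC subrKA mulmxBl.
by rewrite -mulmxA mulmxVp // mulmx1.
Unshelve. all: by end_near. Qed.

End MatrixPerturbation.

(** This produces Lagrange multipliers. The columns of [cokermx J^T], transposed, lie in the kernel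
    of [J], and orthogonality to all of them is membership in the row space of [J^T]. *)
Lemma orthogonal_ker {R : realType} {d m : nat} (J : 'M[R]_(d, m)) (q : 'rV[R]_d) :
  (forall s : 'rV[R]_d, s *m J = 0 -> dot q s = 0) -> (q <= J^T)%MS.
Proof.
move=> qJ; rewrite submxE; apply/eqP/rowP => j; rewrite [RHS]mxE.
have := qJ (row j (cokermx J^T)^T).
rewrite -row_mul -{2}[J]trmxK -trmx_mul mulmx_coker trmx0 row0 => /(_ erefl).
by rewrite /dot tr_row trmxK colE mulmxA -colE mxE.
Qed.

Lemma cvg_quadratic_form {R : realType} {d : nat} (A : 'M[R]_d) (x : 'rV[R]_d) :
  dot (u *m A) u @[u --> x] --> dot (x *m A) x.
Proof.
apply: (cvg_dot (F := nbhs x)); last exact: cvg_id.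
by apply: (cvg_mulmx (F := nbhs x)); [exact: cvg_id|exact: cvg_cst].
Qed.

Lemma nonneg_parabola_slope0 {R : realType} (p q : R) :
  (forall e, 0 <= 2 * e * p + e ^+ 2 * q) -> 0 <= q -> p = 0.
Proof.
move=> pq q0; have c0 : 0 < q + 1 by lra.
(* A nearly minimizing [e]; the shift by one keeps the denominator positive when [q = 0]. *)
have := pq (- p / (q + 1)).
have -> : 2 * (- p / (q + 1)) * p + (- p / (q + 1)) ^+ 2 * q
    = - (p ^+ 2 * (q + 2)) / (q + 1) ^+ 2.
  by field; rewrite gt_eqF.
rewrite pmulr_lge0 ?invr_gt0 ?exprn_gt0 // oppr_ge0 pmulr_lle0; last by lra.
by move=> p2; apply/eqP; rewrite -sqrf_eq0 eq_le p2 sqr_ge0.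
Qed.

(* The maximizer of the Rayleigh quotient of [B] relative to [A] on the unit sphere
   of [ker J] is a generalized eigenvector. *)
Lemma generalized_eigenvector_gt1 {R : realType} {d m : nat}
    (A B : 'M[R]_d) (J : 'M[R]_(d, m)) (u0 : 'rV[R]_d) :
  A^T = A -> B^T = B ->
  (forall s : 'rV[R]_d, s *m J = 0 -> s != 0 -> 0 < dot (s *m A) s) ->
  u0 *m J = 0 -> dot (u0 *m A) u0 < dot (u0 *m B) u0 ->
  exists (l : R) (u : 'rV[R]_d), [/\ 1 < l, u != 0, u *m J = 0 &
    forall s : 'rV[R]_d, s *m J = 0 -> dot (u *m B) s = l * dot (u *m A) s].
Proof.
move=> symA symB Apos u0J AB0.
pose S := [set u : 'rV[R]_d | u *m J = 0 /\ dot u u = 1].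
have Sn0 u : S u -> u != 0.
  by move=> [_ u1]; apply/eqP => uE; move: u1; rewrite uE dot0l => /esym/eqP; rewrite oner_eq0.
have normalize (u : 'rV[R]_d) : u *m J = 0 -> u != 0 ->
    exists2 c, 0 < c & S (c *: u).
  move=> uJ un0; have uu : 0 < dot u u.
    rewrite lt_neqAle dot_ge0 andbT eq_sym; apply: contra un0 => /eqP uu.
    by rewrite (dot_eq0 _ uu).
  have u2 : Num.sqrt (dot u u) != 0 by rewrite gt_eqF // sqrtr_gt0.
  exists (Num.sqrt (dot u u))^-1; first by rewrite invr_gt0 sqrtr_gt0.
  split; first by rewrite -scalemxAl uJ scaler0.
  by rewrite dotZl dotZr mulrA -expr2 exprVn sqr_sqrtr ?dot_ge0 // mulVf // gt_eqF.
have un0 : u0 != 0 by apply: contraTneq AB0 => ->; rewrite !mul0mx dot0l ltxx.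
have Scompact : compact S.
  apply: bounded_closed_compact.
    exists 1; split; first exact: num_real.
    move=> x x1 u [_ uu]; apply: le_trans (ltW x1).
    by rewrite (le_trans (norm_le_enorm u)) // /enorm uu sqrtr1.
  apply: closedI.
    apply: (@closed_comp _ _ (fun u : 'rV[R]_d => u *m J) [set 0]).
      move=> u _; apply: (cvg_mulmx (F := nbhs u)); [exact: cvg_id|exact: cvg_cst].
    exact: (accessible_closed_set1 (hausdorff_accessible (@norm_hausdorff _ _))).
  apply: (@closed_comp _ _ (fun u : 'rV[R]_d => dot u u) [set 1]).
    by move=> u _; apply: (cvg_dot (F := nbhs u)); exact: cvg_id.
  exact: (accessible_closed_set1 (hausdorff_accessible (@norm_hausdorff _ _))).
pose phi (u : 'rV[R]_d) := dot (u *m B) u / dot (u *m A) u.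
have S0 : S !=set0 by have [c _ Sc] := normalize _ u0J un0; exists (c *: u0).
have phi_cont : {within S, continuous phi}.
  apply: continuous_in_subspaceT => u; rewrite inE => Su.
  apply: (cvgM (cvg_quadratic_form B u)); apply: cvgV.
    by rewrite gt_eqF // Apos ?Sn0 //; case: Su.
  exact: (cvg_quadratic_form A u).
have [u] := EVT_max_rV S0 Scompact phi_cont.
rewrite inE => Su umax; have [uJ _] := Su; set l := phi u.
(* By maximality [l *: A - B] is positive semidefinite on [ker J], and it vanishes at [u].
   Perturbing [u] along [s] then gives a nonnegative parabola through the origin, so its slope, the
   bilinear form at [u] and [s], is zero. *)
have PA (s : 'rV[R]_d) : s *m J = 0 -> 0 <= dot (s *m (l *: A - B)) s.
  move=> sJ; have [->|sn0] := eqVneq s 0; first by rewrite mul0mx dot0l.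
  have [c c0 Sc] := normalize _ sJ sn0.
  have := umax (c *: s); rewrite inE => /(_ Sc); rewrite -/l /phi.
  rewrite -!scalemxAl !dotZl !dotZr !mulrA -mulf_div divff ?mul1r ?mulf_neq0 ?gt_eqF //.
  rewrite ler_pdivrMr ?Apos // => le1.
  by rewrite mulmxBr dotBl -scalemxAr dotZl subr_ge0.
have Pu : dot (u *m (l *: A - B)) u = 0.
  rewrite mulmxBr dotBl -scalemxAr dotZl /l /phi divfK ?subrr //.
  by rewrite gt_eqF // Apos // Sn0.
exists l, u; split=> //; last first.
- move=> s sJ; suff P0 : dot (u *m (l *: A - B)) s = 0.
    by move/eqP: P0; rewrite mulmxBr dotBl -scalemxAr dotZl subr_eq0 => /eqP.
  apply: (nonneg_parabola_slope0 _ (dot (s *m (l *: A - B)) s)); last exact: PA.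
  move=> e; have := PA (u + e *: s); rewrite mulmxDl -scalemxAl uJ sJ scaler0 addr0.
  move=> /(_ erefl); rewrite mulmxDl -scalemxAl !dotDl !dotDr !dotZl !dotZr Pu.
  have -> : dot (s *m (l *: A - B)) u = dot (u *m (l *: A - B)) s.
    by rewrite dot_mulmxl dotC linearB linearZ /= symA symB.
  by congr (0 <= _); ring.
- exact: Sn0.
have [c c0 Sc] := normalize _ u0J un0.
apply: lt_le_trans (umax (c *: u0) _); last by rewrite inE.
rewrite /phi -!scalemxAl !dotZl !dotZr !mulrA -mulf_div divff ?mul1r ?mulf_neq0 ?gt_eqF //.
by rewrite ltr_pdivlMr ?mul1r // Apos.
Qed.

(** * Level sets *)

Section Jacobian.
Context {R : realType} {d m : nat}.
Implicit Types (G : 'rV[R]_d -> 'rV[R]_m) (a : 'rV[R]_d).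

Lemma differentiable_component G a j :
  differentiable G a -> differentiable (fun x => G x 0 j) a.
Proof.
move=> dG.
exact: (differentiable_comp (f := G) (g := fun N : 'rV[R]_m => N 0 j) dG
  (differentiable_coord _ _ _)).
Qed.

Lemma derive_component G a j v :
  differentiable G a -> 'D_v (fun x => G x 0 j) a = ('D_v G a) 0 j.
Proof. by move=> dG; rewrite derive_mx ?mxE //; exact: diff_derivable. Qed.

Lemma jacobianE G a : differentiable G a ->
  'J G a = \matrix_(i, j) gradient (fun x => G x 0 j) a 0 i.
Proof.
move=> dG; apply/matrixP => i j; rewrite [RHS]mxE [RHS]mxE.
by rewrite derive_component // deriveEjacobian // -rowE [RHS]mxE.
Qed.

Lemma jacobian_slope G a : differentiable G a ->
  exists Q : 'rV[R]_d -> 'M[R]_(d, m),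
    Q x @[x --> a] --> 'J G a /\ forall x, G x = G a + (x - a) *m Q x.
Proof.
move=> dG; have /choice [q qP] j := gradient_slope _ _ (differentiable_component _ _ j dG).
exists (fun x => \matrix_(i, j) q j x 0 i); split.
  rewrite jacobianE //; apply: (cvg_matrix_of_fun (F := nbhs a)) => i j.
  by have [/(cvg_coord 0 i) + _ _] := qP j.
move=> x; apply/rowP => j; have [_ _ qE] := qP j.
rewrite !mxE qE dotE; congr (_ + _).
by apply: eq_bigr => i _; rewrite !mxE.
Qed.

(** Up to a factor two the conclusion is the one-sided derivative of [|G|^2] along [v], obtained as
    the limit of difference quotients. *)
Lemma stationary_component G a v : differentiable G a ->
  (\forall t \near (0 : R)^'+, dot (G a) (G a) <= dot (G (a + t *: v)) (G (a + t *: v))) ->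
  0 <= dot (v *m 'J G a) (G a).
Proof.
move=> dG minG; have [Q [Qa GQ]] := jacobian_slope _ _ dG.
have at0 : a + t *: v @[t --> (0 : R)^'+] --> a.
  rewrite -[X in _ --> X]addr0; apply: (@cvgD _ _ _ (0^'+) _ (fun=> a)); first exact: cvg_cst.
  by rewrite -(scale0r v); apply: (@cvgZr_tmp _ _ _ (0^'+)); exact: cvg_within.
have vQ : v *m Q (a + t *: v) @[t --> (0 : R)^'+] --> v *m 'J G a.
  apply: (cvg_mulmx (F := 0^'+)); [exact: cvg_cst|exact: cvg_comp at0 Qa].
have lim : 2 * dot (v *m Q (a + t *: v)) (G a) +
      t * dot (v *m Q (a + t *: v)) (v *m Q (a + t *: v)) @[t --> (0 : R)^'+] -->
    2 * dot (v *m 'J G a) (G a) + 0 * dot (v *m 'J G a) (v *m 'J G a).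
  apply: cvgD; apply: cvgM.
  - exact: cvg_cst.
  - by apply: (cvg_dot (F := 0^'+)) => //; exact: cvg_cst.
  - exact: cvg_within.
  - exact: (cvg_dot (F := 0^'+)).
suff : 0 <= 2 * dot (v *m 'J G a) (G a) + 0 * dot (v *m 'J G a) (v *m 'J G a) by lra.
apply: (cvg_frequently_ge0 _ _ lim) => V FV.
have [t [[Vt mint] t0]] := filter_ex (filterI (filterI FV minG) (nbhs_right_gt (0 : R))).
exists t => //.
rewrite -(pmulr_rge0 _ t0).
move: mint; rewrite (GQ (a + t *: v)) [a + _ - a]addrAC subrr add0r.
rewrite -scalemxAl !dotDl !dotDr !dotZl !dotZr.
rewrite [dot (G a) (v *m _)]dotC -subr_ge0; congr (0 <= _); ring.
Qed.

(* With [W] a right inverse of the differential, minimize [|G|^2] over the points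
   [y + t (s + w W)] with [w] in a small ball: as [G (y + t (s + w W)) = t (w + o(1))], the
   minimizer is interior, hence stationary, and stationary points are zeros of [G]. *)
Lemma tangent_realizable G y s :
  (forall x, differentiable G x) -> 'J G x @[x --> y] --> 'J G y ->
  row_full ('J G y) -> G y = 0 -> s *m 'J G y = 0 ->
  forall V : set (R * 'rV[R]_d), filter_prod (0 : R)^'+ (nbhs s) V ->
  exists2 z, V z & G (y + z.1 *: z.2) = 0.
Proof.
move=> dG Jc Jfull Gy sJ V [[A B] /= [A0 Bs] ABV].
have [Q [Qy GQ]] := jacobian_slope _ _ (dG y).
pose W := pinvmx ('J G y); have WJ : W *m 'J G y = 1%:M by exact: mulVpmx.
have [e e0 eB] : exists2 e : R, 0 < e &
    forall w : 'rV[R]_m, dot w w <= e -> B (s + w *m W).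
  have sW : s + w *m W @[w --> (0 : 'rV[R]_m)] --> s.
    rewrite -[X in _ --> X]addr0; apply: (@cvgD _ _ _ (nbhs (0 : 'rV[R]_m)) _ (fun=> s)).
      exact: cvg_cst.
    rewrite -(mul0mx _ W); apply: (cvg_mulmx (F := nbhs (0 : 'rV[R]_m))); last exact: cvg_cst.
    exact: cvg_id.
  have /nbhs_ballP [e /= e0 eP] := sW _ Bs.
  exists ((e / 2) ^+ 2) => [|w we]; first by rewrite exprn_gt0 // divr_gt0.
  apply: eP; rewrite -ball_normE /= sub0r normrN.
  have : `|w| <= e / 2.
    rewrite -(ler_pXn2r (_ : 0 < 2)%N) ?nnegrE ?divr_ge0 ?(ltW e0) //.
    exact: le_trans (norm_sqr_le_dot _) we.
  lra.
pose K : set 'rV[R]_m := [set w | dot w w <= e].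
have Kcompact : compact K.
  apply: bounded_closed_compact.
    exists (Num.sqrt e); split; first exact: num_real.
    move=> x ex w we; apply: le_trans (ltW ex).
    by rewrite (le_trans (norm_le_enorm w)) // ler_wsqrtr.
  apply: (@closed_comp _ _ (fun w : 'rV[R]_m => dot w w) [set x | x <= e]).
    by move=> w _; apply: (cvg_dot (F := nbhs w)); exact: cvg_id.
  exact: closed_le.
pose x t w := y + t *: (s + w *m W).
have [C C0 SC] : exists2 C : R, 0 < C & forall w, K w -> `|s + w *m W| <= C.
  exists (`|s| + m%:R * Num.sqrt e * `|W| + 1).
    by rewrite ltr_wpDl // addr_ge0 // !mulr_ge0 // sqrtr_ge0.
  move=> w we; rewrite (le_trans (ler_normD _ _)) // -addrA lerD2l.
  rewrite ler_wpDr // (le_trans (norm_mulmx_le _ _)) // ler_wpM2r // ler_wpM2l //.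
  by rewrite (le_trans (norm_le_enorm w)) // ler_wsqrtr.
have x_near (P : set 'rV[R]_d) : nbhs y P -> \forall t \near (0 : R)^'+, forall w, K w -> P (x t w).
  move=> /nbhs_ballP [r /= r0 rP]; near=> t => w Kw; apply: rP.
  rewrite -ball_normE /= /x opprD addrA subrr sub0r normrN normrZ.
  have t0 : 0 < t by near: t; exact: nbhs_right_gt.
  have tr : t < r / C by near: t; apply: nbhs_right_lt; rewrite divr_gt0.
  rewrite gtr0_norm // (le_lt_trans (ler_wpM2l (ltW t0) (SC _ Kw))) //.
  by rewrite -ltr_pdivlMr.
(* If [|w + err w|^2] and [|err w|^2] are at most [c], then [|w|^2 <= 4 c = e / 4 < e], which keeps
   the minimizer off the boundary of [K]. *)
pose c := e / 16.
have c0 : 0 < c by rewrite divr_gt0.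
have small : \forall z \near y, forall w, K w ->
    dot ((s + w *m W) *m (Q z - 'J G y)) ((s + w *m W) *m (Q z - 'J G y)) <= c.
  (* [k] collects the factors lost in passing from the squared Euclidean norm of [D] to the maximum
     norm of [Q z - 'J G y]. *)
  pose k : R := m.+1%:R * (d.+1%:R * C) ^+ 2.
  have k0 : 0 < k by rewrite mulr_gt0 // exprn_gt0 // mulr_gt0.
  have ck : 0 < Num.sqrt (c / k) by rewrite sqrtr_gt0 divr_gt0.
  move/cvgrPdist_le: Qy => /(_ _ ck); apply: filterS => z Qz w Kw.
  set D := _ *m _.
  have nD : `|D| <= d.+1%:R * C * Num.sqrt (c / k).
    rewrite (le_trans (norm_mulmx_le _ _)) // ler_pM ?mulr_ge0 //; last by rewrite distrC.
    by rewrite ler_pM ?ler_nat // SC.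
  rewrite (le_trans (dot_le_norm_sqr _)) //.
  have : `|D| ^+ 2 <= (d.+1%:R * C) ^+ 2 * (c / k).
    rewrite -[c / k]sqr_sqrtr; last by rewrite divr_ge0 // ltW.
    by rewrite -exprMn lerXn2r // nnegrE // !mulr_ge0 // ?sqrtr_ge0 // ltW.
  move=> D2; rewrite (le_trans (ler_wpM2l (ler0n _ _) D2)) //.
  rewrite (@le_trans _ _ (k * (c / k))) //; last by rewrite mulrCA divff ?mulr1 // gt_eqF.
  rewrite /k -mulrA ler_wpM2r ?ler_nat // mulr_ge0 ?sqr_ge0 // divr_ge0 // ?(ltW c0) //.
  exact: ltW.
(* [W *m 'J G z] is close to the identity, so stationarity along the range of [W] alone forces [G]
   to vanish. *)
have WJfree : \forall z \near y, row_free (W *m 'J G z)^T.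
  apply: (near_row_free (F := nbhs y) (fun z => (W *m 'J G z)^T) (W *m 'J G y)^T).
    apply: (cvg_trmx (F := nbhs y)); apply: (cvg_mulmx (F := nbhs y)) => //; exact: cvg_cst.
  by rewrite WJ trmx1 row_free_unit unitmx1.
have [t [[[At t0] tsmall] tfree]] : exists t : R, ((A t /\ 0 < t) /\
    (forall w, K w -> forall w', K w' -> dot ((s + w' *m W) *m (Q (x t w) - 'J G y))
      ((s + w' *m W) *m (Q (x t w) - 'J G y)) <= c)) /\
    (forall w, K w -> row_free (W *m 'J G (x t w))^T).
  near (0 : R)^'+ => t; exists t; do !split.
  - by near: t.
  - by near: t; exact: nbhs_right_gt.
  - by near: t; exact: x_near small.
  - by near: t; exact: x_near WJfree.
pose p w := dot (G (x t w)) (G (x t w)).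
have K0 : K !=set0 by exists 0; rewrite /K /= dot0l ltW.
have p_cont : {within K, continuous p}.
  apply: continuous_subspaceT => w.
  have xc : x t w' @[w' --> w] --> x t w.
    apply: (@cvgD _ _ _ (nbhs w) _ (fun=> y)); first exact: cvg_cst.
    apply: (@cvgZl_tmp _ _ _ (nbhs w)).
    apply: (@cvgD _ _ _ (nbhs w) _ (fun=> s)); first exact: cvg_cst.
    by apply: (cvg_mulmx (F := nbhs w)); [exact: cvg_id|exact: cvg_cst].
  have Gc : G (x t w') @[w' --> w] --> G (x t w).
    exact: (cvg_comp _ _ xc (differentiable_continuous (dG (x t w)))).
  exact: (cvg_dot (F := nbhs w)).
have [w] := EVT_min_rV K0 Kcompact p_cont.
rewrite inE => Kw wmin.
pose err w := (s + w *m W) *m (Q (x t w) - 'J G y).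
have GE w' : G (x t w') = t *: (w' + err w').
  rewrite GQ Gy add0r /x addrAC subrr add0r -scalemxAl /err mulmxBr [_ *m 'J G y]mulmxDl sJ add0r.
  by rewrite -mulmxA WJ mulmx1 addrCA subrr addr0.
have w_int : dot w w < e.
  have K0' : 0 \in K by rewrite inE /K /= dot0l ltW.
  have le0 : dot (w + err w) (w + err w) <= dot (err 0) (err 0).
    have := wmin _ K0'; rewrite /p !GE add0r !dotZl !dotZr !mulrA -expr2.
    by rewrite ler_pM2l // exprn_gt0.
  have e1 : dot (err 0) (err 0) <= c by apply: tsmall; rewrite /K /= dot0l ltW.
  have e2 : dot (err w) (err w) <= c by apply: tsmall.
  have := dot_ge0 (w + 2 *: err w).
  move: le0 e1 e2; rewrite !dotDl !dotDr !dotZl !dotZr [dot (err w) w]dotC.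
  move: (dot w w) (dot w _) (dot (err w) _) (dot (err 0) _) => A1 A2 A3 A4.
  rewrite /c; move: e0; clear; lra.
have Gx0 : G (x t w) = 0.
  (* The steepest descent direction of [|G|^2] in the parameter [w]: stationarity makes minus the
     squared norm of [u] nonnegative. Moving [x t w] by [t' *: (u *m W)] means moving [w] by
     [(t' / t) *: u], which stays in [K] for small [t']. *)
  set u := - (G (x t w) *m (W *m 'J G (x t w))^T).
  have : 0 <= dot (u *m W *m 'J G (x t w)) (G (x t w)).
    apply: stationary_component => //.
    have lineE t' : x t (w + (t' / t) *: u) = x t w + t' *: (u *m W).
      rewrite /x mulmxDl addrA [t *: (s + _ + _)]scalerDr addrA -scalemxAl scalerA.
      by rewrite mulrCA divff ?mulr1 // gt_eqF.
    have lim : dot (w + (t' / t) *: u) (w + (t' / t) *: u) @[t' --> (0 : R)^'+] --> dot w w.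
      have : w + (t' / t) *: u @[t' --> (0 : R)^'+] --> w.
        rewrite [X in _ --> X](_ : w = w + (0 / t) *: u); last by rewrite mul0r scale0r addr0.
        apply: (@cvgD _ _ _ (0^'+) _ (fun=> w)); first exact: cvg_cst.
        apply: (@cvgZr_tmp _ _ _ (0^'+)); apply: cvgM; [exact: cvg_within|exact: cvg_cst].
      by move=> wl; exact: (cvg_dot (F := 0^'+)).
    move/cvgr_lt: lim => /(_ _ w_int); apply: filterS => t' Kt.
    by have := wmin _ (mem_set (ltW Kt : K _)); rewrite /p lineE.
  rewrite /u -mulmxA mulNmx dotNl dot_mulmxl oppr_ge0 => le0.
  have /dot_eq0 : dot (G (x t w) *m (W *m 'J G (x t w))^T) (G (x t w) *m (W *m 'J G (x t w))^T) = 0.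
    by apply/eqP; rewrite eq_le le0 dot_ge0.
  by move=> /eqP; rewrite mulmx_free_eq0 ?tfree // => /eqP.
exists (t, s + w *m W) => //; apply: ABV; split=> //=; exact: eB.
Unshelve. all: by end_near. Qed.

End Jacobian.

(** * Subgradients and proximal maps of weakly convex functions *)

Lemma abs_dot_le {R : realType} {d : nat} (u v : 'rV[R]_d) :
  `|dot u v| <= d%:R * `|u| * `|v|.
Proof.
rewrite dotE (le_trans (ler_norm_sum _ _ _)) //.
rewrite (le_trans (ler_sum _ (G := fun=> `|u| * `|v|) _)) // => [k _|].
  by rewrite normrM ler_pM // coord_le_norm.
by rewrite sumr_const card_ord -mulrA mulr_natl.
Qed.

Section Subdifferential.
Context {R : realType} {d : nat}.
Implicit Types (h : 'rV[R]_d -> \bar R) (x y v : 'rV[R]_d).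

Lemma subdifferential_add h (g : 'rV[R]_d -> R) y v :
  differentiable g y -> subdifferential h y v ->
  subdifferential (fun x => (g x)%:E + h x)%E y (v + gradient g y).
Proof.
move=> dg [hy hv]; split; first by rewrite fin_numD.
move=> e e0; have e2 : 0 < e / 2 by rewrite divr_gt0.
have [q [qy _ gq]] := gradient_slope _ _ dg.
have c0 : 0 < e / 2 / d.+1%:R by rewrite divr_gt0.
move/cvgrPdist_le: qy => /(_ _ c0) qy.
near=> x.
have hx : (h y + (dot v (x - y) - e / 2 * enorm (x - y))%:E <= h x)%E.
  by near: x; exact: hv.
have qx : `|gradient g y - q x| <= e / 2 / d.+1%:R by near: x.
have gx : g y + dot (gradient g y) (x - y) - e / 2 * enorm (x - y) <= g x.
  rewrite (gq x) -addrA lerD2l dotC -[X in dot _ X](subrK (q x)) dotDr.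
  rewrite -addrA addrC -addrA gerDl addrC subr_le0 (le_trans (ler_norm _)) //.
  rewrite (le_trans (abs_dot_le _ _)) //.
  rewrite (le_trans (ler_pM _ _ (lexx _) qx)) ?mulr_ge0 //.
  rewrite mulrC mulrA ler_pM ?mulr_ge0 ?norm_le_enorm //; try exact: ltW.
  by rewrite mulrAC ler_pdivrMr // ler_wpM2l ?ler_nat // ltW.
rewrite -(fineK hy) -addeA -!EFinD; move: hx; rewrite -(fineK hy) -EFinD.
case: (h x) => [b| |] //=; rewrite -?EFinD ?lee_fin //; last by move=> _; rewrite leey.
by rewrite dotDl => hx; move: hx gx e0; lra.
Unshelve. all: by end_near. Qed.

Lemma subdifferential_sub h (g : 'rV[R]_d -> R) y v :
  differentiable g y -> subdifferential (fun x => (g x)%:E + h x)%E y v ->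
  subdifferential h y (v - gradient g y).
Proof.
move=> dg fv; have dNg : differentiable (- g) y by exact: differentiableN.
have := subdifferential_add _ (- g) _ _ dNg fv.
have -> : gradient (- g) y = - gradient g y.
  by apply/rowP => i; rewrite !mxE deriveN //; exact: diff_derivable.
by congr (subdifferential _ _ _); apply/funext => x; rewrite addeA -EFinD addNr add0e.
Qed.

(** The local inequality becomes global: it is used at [y + t *: (x - y)] for one small [t],
    compared with weak convexity along the segment, and divided by [t]; the error is absorbed in an
    arbitrary [e]. *)
Lemma weakly_convex_subgradient (rho : R) h y v : 0 < rho ->
  weakly_convex rho h -> (forall x, h x != -oo%E) -> subdifferential h y v ->
  forall x, (h y + (dot v (x - y) - rho / 2 * dot (x - y) (x - y))%:E <= h x)%E.
Proof.
move=> rho0 wc hNoo [hy hv] x; have := hNoo x.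
move: (fineK hy); set a := fine (h y) => ha; rewrite -ha.
case hx : (h x) => [b| |] // _; last by rewrite leey.
rewrite -EFinD lee_fin; apply/ler_addgt0Pl => e e0.
set w := x - y.
(* Times [enorm w] this is at most [e], also when [w = 0]. *)
have c0 : 0 < e / (enorm w + 1) by rewrite divr_gt0 // ltr_wpDl // sqrtr_ge0.
have at0 : y + t *: w @[t --> (0 : R)^'+] --> y.
  rewrite [X in _ --> X](_ : y = y + 0 *: w); last by rewrite scale0r addr0.
  apply: (@cvgD _ _ _ (0^'+) _ (fun=> y)); first exact: cvg_cst.
  by apply: (@cvgZr_tmp _ _ _ (0^'+)); exact: cvg_within.
have ev : \forall t \near (0 : R)^'+,
  (h y + (dot v (y + t *: w - y)%R - e / (enorm w + 1) * enorm (y + t *: w - y)%R)%R%:E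
    <= h (y + t *: w)%R)%E := at0 _ (hv _ c0).
have [t [[near_t t1] t0]] := filter_ex (filterI (filterI ev
  (nbhs_right_lt (ltr01 : (0 : R) < 1))) (nbhs_right_gt (0 : R))).
have := wc x y t; rewrite (ltW t0) (ltW t1) => /(_ isT).
have -> : t *: x + (1 - t) *: y = y + t *: w.
  by rewrite scalerBl scale1r addrCA -scalerBr.
move: near_t; rewrite -ha hx -!EFinD addrAC subrr add0r.
have -> : enorm (t *: w) = t * enorm w.
  by rewrite /enorm dotZl dotZr mulrA -expr2 sqrtrM ?sqr_ge0 // sqrtr_sqr gtr0_norm.
case: (h (y + t *: w)) => [c| |] //; rewrite -?EFinM -?EFinD ?lee_fin // => le1 le2.
have xE : x = y + w by rewrite /w addrC subrK.
clearbody w.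
have enw : 0 <= enorm w by exact: sqrtr_ge0.
have c1 : e / (enorm w + 1) * enorm w <= e.
  by rewrite mulrAC ler_pdivrMr ?ltr_wpDl // ler_pM2l // lerDl.
have ww : 0 <= rho / 2 * dot w w * t by rewrite !mulr_ge0 ?dot_ge0 // ltW.
move: le1 le2; rewrite !enorm_sqr xE !dotDl !dotDr !dotZl !dotZr [dot w y]dotC.
move: (e / _) c0 c1 => k k0 ke le1 le2.
rewrite -(ler_pM2l t0).
have : t * (k * enorm w) <= t * e by rewrite ler_pM2l.
have : 0 <= t * (rho / 2 * dot w w * t) by rewrite mulr_ge0 // ltW.
move: le1 le2; clear; lra.
Qed.

End Subdifferential.

(** * Existence, characterization and Lipschitz continuity of the proximal point *)

Section Prox.
Context {R : realType} {d : nat}.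
Variables (r : 'rV[R]_d -> \bar R) (rho mu : R).
Hypotheses (rNoo : forall x, r x != -oo%E) (r_closed : closed_fun r).
Hypotheses (rho0 : 0 < rho) (r_wc : weakly_convex rho r).
Hypotheses (mu0 : 0 < mu) (mu_rho : mu * rho < 1).
Variables (y0 v0 : 'rV[R]_d).
Hypothesis sub0 : subdifferential r y0 v0.

(** Fermat's rule: expanding the square about [y] leaves the remainder [|x - y|^2 / (2 mu)], which
    is [o(|x - y|)]. Finiteness of [r y] comes from comparison with [y0]. *)
Lemma prox_argmin_subdifferential z y :
  prox_argmin mu r z y -> subdifferential r y (mu^-1 *: (z - y)).
Proof.
move=> miny; have ry : r y \is a fin_num.
  have := miny y0; case: sub0 => r0 _.
  rewrite -(fineK r0) -EFinD fin_numE rNoo /=.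
  by case: (r y).
split=> // e e0.
have : \forall x \near y, (2 * mu)^-1 * (d%:R * `|x - y|) <= e.
  have lim : (2 * mu)^-1 * (d%:R * `|x - y|) @[x --> y] --> (2 * mu)^-1 * (d%:R * `|y - y|).
    apply: (@cvgM _ _ (nbhs y)); first exact: cvg_cst.
    apply: (@cvgM _ _ (nbhs y)); first exact: cvg_cst.
    apply: (@cvg_norm _ _ _ (nbhs y)).
    by apply: (@cvgB _ _ _ (nbhs y) _ id (fun=> y)); [exact: cvg_id|exact: cvg_cst].
  move: lim; rewrite subrr normr0 !mulr0 => /cvgr_lt /(_ _ e0).
  by apply: filterS => x /ltW.
apply: filterS => x xe; have := miny x; rewrite -(fineK ry) -!EFinD.
have := rNoo x; case: (r x) => [b| |] // _; rewrite -?EFinD ?lee_fin ?leey //.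
rewrite !enorm_sqr => le1.
have le2 : (2 * mu)^-1 * dot (x - y) (x - y) <= e * enorm (x - y).
  rewrite (le_trans (ler_wpM2l _ (dot_le_norm_sqr _))) ?invr_ge0 ?mulr_ge0 ?(ltW mu0) //.
  rewrite expr2 [d%:R * _]mulrA [_^-1 * _]mulrA.
  by rewrite ler_pM ?norm_le_enorm // mulr_ge0 ?mulr_ge0 // invr_ge0 mulr_ge0 // ltW.
have E : dot (x - z) (x - z) = dot (x - y) (x - y) - 2 * dot (z - y) (x - y) + dot (y - z) (y - z).
  by rewrite !dotBl !dotBr [dot y x]dotC [dot z x]dotC [dot z y]dotC; ring.
move: le1; rewrite E dotZl.
have -> : mu^-1 = 2 * (2 * mu)^-1 by rewrite invfM mulrA divff ?mul1r.
lra.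
Qed.

(** The defect [rho / 2 |x - y|^2] of weak convexity is dominated by the proximal term, as
    [mu * rho < 1]. *)
Lemma subdifferential_prox_argmin y v :
  subdifferential r y v -> prox_argmin mu r (y + mu *: v) y.
Proof.
move=> vy x; have ry : r y \is a fin_num by case: vy.
have := weakly_convex_subgradient _ _ _ _ rho0 r_wc rNoo vy x.
rewrite -(fineK ry) -!EFinD.
have := rNoo x; case: (r x) => [b| |] // _; rewrite -?EFinD ?lee_fin ?leey //.
rewrite !enorm_sqr => le1.
have -> : x - (y + mu *: v) = (x - y) - mu *: v by rewrite opprD addrA.
have -> : y - (y + mu *: v) = - (mu *: v) by rewrite opprD addrA subrr add0r.
set w := x - y; rewrite -/w in le1; clearbody w.
rewrite dotNl dotNr opprK dotBl !dotBr !dotZl !dotZr [dot w v]dotC.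
have ww := dot_ge0 w.
have : 0 <= (2 * mu)^-1 * ((1 - mu * rho) * dot w w).
  by rewrite mulr_ge0 ?invr_ge0 ?mulr_ge0 // ?subr_ge0 ltW.
move: (dot w w) (dot v w) (dot v v) le1 => W P V le1.
have -> : (2 * mu)^-1 * ((1 - mu * rho) * W) = (2 * mu)^-1 * W - rho / 2 * W.
  by field; rewrite gt_eqF.
have -> : (2 * mu)^-1 * (W - mu * P - (mu * P - mu * (mu * V))) =
   (2 * mu)^-1 * W - P + (2 * mu)^-1 * (mu * (mu * V)).
  by field; rewrite gt_eqF.
lra.
Qed.

(** Adding the two global subgradient inequalities gives [(1 - mu rho) |w|^2 <= <z' - z, w>] for
    [w = y' - y]; nonnegativity of [|z' - z - (1 - mu rho) w|^2] then plays the part of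
    Cauchy-Schwarz. *)
Lemma prox_argmin_lipschitz z z' y y' :
  prox_argmin mu r z y -> prox_argmin mu r z' y' ->
  (1 - mu * rho) ^+ 2 * dot (y' - y) (y' - y) <= dot (z' - z) (z' - z).
Proof.
move=> /prox_argmin_subdifferential sy /prox_argmin_subdifferential sy'.
have [ry ry'] : r y \is a fin_num /\ r y' \is a fin_num by case: sy sy' => + _ [+ _].
have := weakly_convex_subgradient _ _ _ _ rho0 r_wc rNoo sy y'.
have := weakly_convex_subgradient _ _ _ _ rho0 r_wc rNoo sy' y.
rewrite -(fineK ry) -(fineK ry') -!EFinD !lee_fin -[y - y']opprB !dotNr !dotNl !dotZl opprK.
set w := y' - y.
have -> : z' - y' = (z' - z) + (z - y) - w by rewrite /w opprB !subrKA.
clearbody w.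
move=> le1 le2; have k0 : 0 < 1 - mu * rho by rewrite subr_gt0.
have le3 : (1 - mu * rho) * dot w w <= dot (z' - z) w.
  move: le1 le2; rewrite dotBl dotDl => le1 le2.
  have : 0 <= mu * (mu^-1 * (dot (z' - z) w - dot w w) + rho * dot w w).
    by rewrite mulr_ge0 ?(ltW mu0) //; lra.
  by rewrite [mu * _]mulrDr mulVKf ?gt_eqF //; lra.
move: (z' - z) le3 => D le3; have := dot_ge0 (D - (1 - mu * rho) *: w).
rewrite dotBl !dotBr !dotZl !dotZr [dot w D]dotC.
have : (1 - mu * rho) * ((1 - mu * rho) * dot w w) <= (1 - mu * rho) * dot D w.
  by rewrite ler_pM2l.
move: (1 - mu * rho) => k; lra.
Qed.

(* [r] attains its penalized minimum because the pairs [(x, t)] of the epigraph lying in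
   a large box form a compact set, on which [t + |x - z|^2 / (2 mu)] is continuous. *)
Lemma prox_argmin_exists z : exists y, prox_argmin mu r z y.
Proof.
have r0 : r y0 \is a fin_num by case: sub0.
pose a0 := fine (r y0); have ra0 : r y0 = a0%:E by rewrite fineK.
have glob x := weakly_convex_subgradient _ _ _ _ rho0 r_wc rNoo sub0 x.
rewrite ra0 in glob.
pose q x := (2 * mu)^-1 * dot (x - z) (x - z).
have q_ge0 x : 0 <= q x by rewrite mulr_ge0 ?dot_ge0 // invr_ge0 mulr_ge0 // ltW.
(* The objective is at least its value at [y0] plus [<b, w> + k / 2 |w|^2] with [w = x - y0]; the
   squared radius [C] is where the quadratic term begins to outweigh the linear one. *)
pose b := v0 + mu^-1 *: (y0 - z).
have bE w : dot b w = dot v0 w + mu^-1 * dot (y0 - z) w by rewrite /b dotDl dotZl.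
clearbody b.
pose k := mu^-1 - rho.
have k0 : 0 < k by rewrite subr_gt0 -(ltr_pM2l mu0) mulfV ?gt_eqF.
pose C := 4 * dot b b / k ^+ 2.
have C0 : 0 <= C by rewrite mulr_ge0 ?invr_ge0 ?sqr_ge0 // mulr_ge0 // dot_ge0.
have far x c : r x = c%:E -> C < dot (x - y0) (x - y0) -> a0 + q y0 <= c + q x.
  move=> rx; have := glob x; rewrite rx -EFinD lee_fin; rewrite /q.
  have -> : x - z = (x - y0) + (y0 - z) by rewrite subrKA.
  have := dot_ge0 (b + (k / 2) *: (x - y0)); rewrite /C ltr_pdivrMr ?exprn_gt0 //.
  set w := x - y0; clearbody w.
  move: (bE w); move: (y0 - z) => h bw.
  rewrite !dotDl !dotDr !dotZl !dotZr [dot w b]dotC [dot w h]dotC.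
  move=> h1 h2 h3; have : 0 <= k * (dot b w + k / 2 * dot w w) by lra.
  rewrite pmulr_rge0 // bw /k.
  have -> : mu^-1 = 2 * (2 * mu)^-1 by rewrite invfM mulrA divff ?mul1r.
  lra.
(* A lower bound of [r] on the ball [D], from [<v0, w> >= - |v0|^2 / 2 - |w|^2 / 2]. [M] is the
   objective at [y0]: as [q >= 0], values of [r] above it cannot improve on [y0]. *)
pose m := a0 - dot v0 v0 / 2 - (1 + rho) / 2 * C.
pose M := a0 + q y0.
pose D := [set x : 'rV[R]_d | dot (x - y0) (x - y0) <= C].
pose K := D `*` `[m, M]%classic.
have m_le x c : r x = c%:E -> dot (x - y0) (x - y0) <= C -> m <= c.
  move=> rx xC; have := glob x; rewrite rx -EFinD lee_fin; apply: le_trans.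
  rewrite /m -!addrA lerD2l; move: xC; set w := x - y0; clearbody w => xC.
  have := dot_ge0 (v0 + w); rewrite !dotDl !dotDr [dot w v0]dotC => h.
  have : (1 + rho) / 2 * dot w w <= (1 + rho) / 2 * C.
    by rewrite ler_wpM2l // divr_ge0 // addr_ge0 // ltW.
  lra.
pose E := epigraph r `&` K.
have Dcompact : compact D.
  apply: bounded_closed_compact.
    exists (Num.sqrt C + `|y0|); split; first exact: num_real.
    move=> c cC x xD; apply: le_trans (ltW cC).
    rewrite -{1}[x](subrK y0) (le_trans (ler_normD _ _)) // lerD2r.
    by rewrite (le_trans (norm_le_enorm _)) // ler_wsqrtr.
  apply: (@closed_comp _ _ (fun x : 'rV[R]_d => dot (x - y0) (x - y0)) [set c | c <= C]).
    move=> x _; have xc : x' - y0 @[x' --> x] --> x - y0.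
      by apply: (@cvgB _ _ _ (nbhs x) _ id (fun=> y0)); [exact: cvg_id|exact: cvg_cst].
    exact: (cvg_dot (F := nbhs x)).
  exact: closed_le.
have Ecompact : compact E.
  rewrite /E setIC; apply: compact_closedI => //.
  by apply: compact_setX => //; exact: segment_compact.
have E0 : E !=set0.
  exists (y0, a0); split; first by rewrite /epigraph /= ra0.
  split=> /=; first by rewrite /D /= subrr dot0l.
  rewrite in_itv /= lerDl q_ge0 andbT.
  by apply: (m_le y0) => //; rewrite subrr dot0l.
have p_cont : {within E, continuous (fun p : 'rV[R]_d * R => p.2 + q p.1)}.
  apply: continuous_subspaceT => p; apply: (@cvgD _ _ _ (nbhs p)); first exact: cvg_snd.
  apply: (@cvgM _ _ (nbhs p)); first exact: cvg_cst.
  have pc : p'.1 - z @[p' --> p] --> p.1 - z.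
    by apply: (@cvgB _ _ _ (nbhs p) _ _ (fun=> z)); [exact: cvg_fst|exact: cvg_cst].
  exact: (cvg_dot (F := nbhs p)).
have [[y t]] := compact_EVT_min E0 Ecompact p_cont.
rewrite inE => -[/= ry _] pmin; exists y => x.
rewrite !enorm_sqr -/(q x) -/(q y).
have := rNoo x; case rx : (r x) => [c| |] // _; last by rewrite addye ?leey.
apply: (@le_trans _ _ (t + q y)%:E); first by rewrite EFinD leeD2r.
rewrite -EFinD lee_fin.
have min0 : t + q y <= a0 + q y0.
  apply: (pmin (y0, a0)); rewrite inE; split; first by rewrite /epigraph /= ra0.
  split=> /=; first by rewrite /D /= subrr dot0l.
  rewrite in_itv /= lerDl q_ge0 andbT.
  by apply: (m_le y0) => //; rewrite subrr dot0l.
have [xC|xC] := leP (dot (x - y0) (x - y0)) C; last exact: le_trans min0 (far _ _ rx xC).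
have [cM|/ltW cM] := leP c M; last by rewrite (le_trans min0) // ler_wpDr.
apply: (pmin (x, c)); rewrite inE; split; first by rewrite /epigraph /= rx.
by split=> //=; rewrite in_itv /= cM (m_le x).
Qed.

Lemma proxP z : prox_argmin mu r z (prox mu r z).
Proof. by have [y yz] := prox_argmin_exists z; apply: getPex; exists y. Qed.

Lemma prox_eq z y : prox_argmin mu r z y -> prox mu r z = y.
Proof.
move=> yz; have := prox_argmin_lipschitz _ _ _ _ (proxP z) yz.
rewrite subrr dot0l pmulr_rle0 ?exprn_gt0 ?subr_gt0 // => le0.
by apply/esym/subr0_eq/dot_eq0/eqP; rewrite eq_le le0 dot_ge0.
Qed.

Lemma prox_continuous : continuous (prox mu r).
Proof.
move=> z; apply/(cvgrPdist_le (F := nbhs z)) => e e0.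
have k0 : 0 < 1 - mu * rho by rewrite subr_gt0.
have c0 : 0 < ((1 - mu * rho) * e / d.+1%:R) by rewrite divr_gt0 // mulr_gt0.
have idz : x @[x --> z] --> z by exact: cvg_id.
move/cvgrPdist_le: idz => /(_ _ c0); apply: filterS => z' zz'.
have := prox_argmin_lipschitz _ _ _ _ (proxP z') (proxP z).
set w := _ - prox _ _ _ => le1.
rewrite -(ler_pXn2r (_ : 0 < 2)%N) ?nnegrE ?(ltW e0) //.
rewrite (le_trans (norm_sqr_le_dot _)) // -(ler_pM2l (exprn_gt0 2 k0)).
rewrite (le_trans le1) // (le_trans (dot_le_norm_sqr _)) //.
have : `|z - z'| ^+ 2 <= ((1 - mu * rho) * e / d.+1%:R) ^+ 2.
  by rewrite lerXn2r // nnegrE // ltW.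
move=> le2; rewrite (le_trans (ler_wpM2l (ler0n _ _) le2)) //.
rewrite [(_ / _) ^+ 2]exprMn exprVn mulrCA [(_ * e) ^+ 2]exprMn.
rewrite ler_piMr ?(mulr_ge0 (sqr_ge0 _) (sqr_ge0 _)) //.
rewrite ler_pdivrMr ?exprn_gt0 // mul1r -natrX ler_nat expnS expn1.
by rewrite (leq_trans (leqnSn d)) // leq_pmulr.
Qed.

End Prox.

(** * The proximal-gradient map near an active manifold *)

Lemma Cp_on_subset {R : realType} {d : nat} {W : normedModType R} (p : nat)
    (U V : set 'rV[R]_d) (f : 'rV[R]_d -> W) :
  U `<=` V -> Cp_on p V f -> Cp_on p U f.
Proof.
move=> UV; elim: p f => [f fV x /UV /fV //|p IH f [fV DfV]].
by split=> [x /UV /fV //|v]; apply: IH; exact: DfV.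
Qed.

(** * Derivatives of linear combinations of the constraints *)

Section ConstraintCombination.
Context {R : realType} {d m : nat}.
Implicit Types (G : 'rV[R]_d -> 'rV[R]_m) (l : 'rV[R]_m) (a v : 'rV[R]_d).

Lemma is_diff_dot G l a : differentiable G a ->
  differentiable (fun x => dot l (G x)) a /\
  forall v, 'D_v (fun x => dot l (G x)) a = dot l ('D_v G a).
Proof.
move=> dG.
have dot_lin : linear (fun u : 'rV[R]_m => dot l u : R).
  by move=> c u u'; rewrite dotDr dotZr.
pose L : {linear 'rV[R]_m -> R} :=
  HB.pack (fun u : 'rV[R]_m => dot l u : R) (GRing.isLinear.Build _ _ _ _ _ dot_lin).
have Lc : continuous L.
  by move=> u; apply: (cvg_dot (F := nbhs u)); [exact: cvg_cst|exact: cvg_id].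
have dL : differentiable L (G a) by exact: linear_differentiable.
have dLG : differentiable (L \o G) a by exact: differentiable_comp.
by split=> // v; rewrite (deriveE v dLG) diff_comp // (diff_lin _ Lc) /= deriveE.
Qed.

Lemma Cp_on_dot p G l : Cp_on p setT G -> Cp_on p setT (fun x => dot l (G x)).
Proof.
elim: p G => [G Gc x _|p IH G [dG DG]].
  apply: (cvg_dot (F := nbhs x)); [exact: cvg_cst|exact: Gc].
split=> [x _|v]; first by have [] := is_diff_dot G l x (dG x I).
rewrite (_ : 'D_v _ = fun x => dot l ('D_v G x)); first exact: IH (DG v).
by apply/funext => x; have [_ ->] := is_diff_dot G l x (dG x I).
Qed.

Lemma gradient_dot G l a : differentiable G a ->
  gradient (fun x => dot l (G x)) a = l *m ('J G a)^T.
Proof.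
move=> dG; apply/rowP => i; rewrite mxE; have [_ ->] := is_diff_dot G l a dG.
rewrite deriveEjacobian // -rowE dotE [RHS]mxE.
by apply: eq_bigr => j _; rewrite [(_^T) _ _]mxE [row _ _ _ _]mxE.
Qed.

Lemma jacobian_continuous G a : Cp_on 1 setT G -> 'J G x @[x --> a] --> 'J G a.
Proof.
move=> [dG DG].
have E x : 'J G x = \matrix_(i, j) ('D_(delta_mx 0 i) G x) 0 j.
  apply/matrixP => i j; rewrite [RHS]mxE; have dGx := dG x I.
  by rewrite deriveEjacobian // -rowE [RHS]mxE.
rewrite (E a) (_ : jacobian G = fun x => \matrix_(i, j) ('D_(delta_mx 0 i) G x) 0 j);
  last exact/funext.
apply: (cvg_matrix_of_fun (F := nbhs a)) => i j.
by apply: (cvg_coord (F := nbhs a)); have := (DG (delta_mx 0 i)) a I.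
Qed.

(** The convergence is joint in multiplier and point, since both move with the argument of the
    proximal-gradient map; the Hessian is linear in the multiplier, with second derivatives of [G]
    as coefficients. *)
Lemma hessian_dot_cvg G a {T : Type} {F : set_system T} {FF : Filter F}
    (l : T -> 'rV[R]_m) (x : T -> 'rV[R]_d) l0 :
  Cp_on 2 setT G -> l t @[t --> F] --> l0 -> x t @[t --> F] --> a ->
  hessian (fun z => dot (l t) (G z)) (x t) @[t --> F] --> hessian (fun z => dot l0 (G z)) a.
Proof.
move=> [dG DG] ll xa.
have E k z : hessian (fun z => dot k (G z)) z =
    \matrix_(i, j) dot k ('D_(delta_mx 0 i) ('D_(delta_mx 0 j) G) z).
  apply/matrixP => i j; rewrite /hessian [LHS]mxE [RHS]mxE.
  transitivity ('D_(delta_mx 0 i) (fun y => dot k ('D_(delta_mx 0 j) G y)) z).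
    congr (derive _ _ _); apply/funext => y.
    by have [_ ->] := is_diff_dot G k y (dG y I).
  by have [_ ->] := is_diff_dot ('D_(delta_mx 0 j) G) k z ((DG _).1 z I).
rewrite E; under eq_cvg => t do rewrite E.
apply: cvg_matrix_of_fun => i j; apply: cvg_dot => //.
exact: (cvg_comp _ _ xa ((DG (delta_mx 0 j)).2 (delta_mx 0 i) a I)).
Qed.

End ConstraintCombination.

(** Brings the equations, the smooth representative and the sharpness bound to one common open set,
    with a real constant in place of an extended infimum. *)
Lemma active_manifold_local {R : realType} {d : nat} (f : 'rV[R]_d -> \bar R) M a :
  active_manifold 2 f M a ->
  exists (m : nat) (G : 'rV[R]_d -> 'rV[R]_m) (F : 'rV[R]_d -> R) (W : set 'rV[R]_d),
    [/\ open_nbhs a W, M a, Cp_on 2 setT G /\ row_full ('J G a),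
        Cp_on 2 W F & [/\ forall x, W x -> (M x <-> G x = 0),
        forall x, W x -> M x -> f x = (F x)%:E &
        exists2 c : R, 0 < c & forall x v, W x -> ~ M x -> subdifferential f x v ->
          c <= enorm v]].
Proof.
move=> [Ma [U [Ua [k manU] restr sharp]]].
have Ua' : U a by exact: nbhs_singleton.
have [_ [U' [G [kd U'a G2 Jfull MU]]]] := manU a (conj Ma Ua').
have [V [F [Va F2 fF]]] := restr a (conj Ma Ua').
exists (d - k)%N, G, F, (U° `&` U' `&` V); split=> //.
- apply: open_nbhsI => //; apply: open_nbhsI => //.
  by split; [exact: open_interior|exact: Ua].
- by apply: Cp_on_subset F2 => x [].
split.
- move=> x [[Ux U'x] _]; split=> [Mx|Gx].
    suff : (U' `&` [set y | G y = 0]) x by case.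
    by rewrite -MU; split=> //; split=> //; exact: interior_subset.
  have : (U' `&` [set y | G y = 0]) x by [].
  by rewrite -MU => -[[]].
- move=> x [[Ux _] Vx] Mx; apply: fF; split=> //; split=> //; exact: interior_subset.
have lb x v : U° x -> ~ M x -> subdifferential f x v ->
    (ereal_inf [set (enorm v)%:E | v in
      [set v | exists2 y, (U `\` M) y & subdifferential f y v]] <= (enorm v)%:E)%E.
  move=> Ux Mx fv; apply: ereal_inf_lbound; exists v => //; exists x => //.
  by split=> //; exact: interior_subset.
move: sharp lb; set I := ereal_inf _; case: I => [c| |] // c0 lb.
  by exists c => // x v [[Ux _] _] Mx fv; have := lb x v Ux Mx fv; rewrite lee_fin.
(* An infinite infimum means that there are no subgradients off [M] nearby, so any positive constant
   serves. *)
exists 1 => // x v [[Ux _] _] Mx fv; have := lb x v Ux Mx fv.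
by rewrite leye_eq.
Qed.

(** * Limits along [y + t s'] as [t] decreases to zero and [s'] tends to [s] *)

Section Ray.
Context {R : realType} {d : nat}.
Implicit Types (y s : 'rV[R]_d).
Local Notation ray s := (filter_prod (0 : R)^'+ (nbhs s)).

Lemma cvg_ray_time s : z.1 @[z --> ray s] --> (0 : R).
Proof. by apply: (cvg_trans (cvg_fst (G := nbhs s))); exact: cvg_within. Qed.

Lemma cvg_ray y s : y + z.1 *: z.2 @[z --> ray s] --> y.
Proof.
rewrite [X in _ --> X](_ : y = y + 0 *: s); last by rewrite scale0r addr0.
apply: cvgD; first exact: cvg_cst.
by apply: cvgZ; [exact: cvg_ray_time|exact: cvg_snd].
Qed.

Lemma ray_time_gt0 s : \forall z \near ray s, 0 < z.1.
Proof. exact: (cvg_fst (G := nbhs s) (nbhs_right_gt (0 : R))). Qed.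

End Ray.

Section ProximalGradientMap.
Context {R : realType} {d : nat}.
Variables (g : 'rV[R]_d -> R) (r : 'rV[R]_d -> \bar R) (rho mu : R).
Hypotheses (g2 : Cp_on 2 setT g).
Hypotheses (rNoo : forall x, r x != -oo%E) (r_closed : closed_fun r).
Hypotheses (rho0 : 0 < rho) (r_wc : weakly_convex rho r).
Hypotheses (mu0 : 0 < mu) (mu_rho : mu * rho < 1).
Variable a : 'rV[R]_d.
Hypothesis a_crit : critical (fun x => (g x)%:E + r x)%E a.
Let S x := prox mu r (x - mu *: gradient g x).
Implicit Types x : 'rV[R]_d.

Lemma critical_subdifferential : subdifferential r a (- gradient g a).
Proof.
by rewrite -[- _]add0r; apply: subdifferential_sub => //; case: g2 => + _; apply.
Qed.

Lemma prox_grad_fixed : S a = a.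
Proof.
apply: (prox_eq _ _ _ rNoo r_closed rho0 r_wc mu0 mu_rho _ _ critical_subdifferential).
rewrite -scalerN; apply: (subdifferential_prox_argmin _ rho) => //.
exact: critical_subdifferential.
Qed.

Lemma prox_grad_continuous x : S y @[y --> x] --> S x.
Proof.
have zc : y - mu *: gradient g y @[y --> x] --> x - mu *: gradient g x.
  apply: (@cvgB _ _ _ (nbhs x) _ id); first exact: cvg_id.
  apply: (@cvgZl_tmp _ _ _ (nbhs x)).
  by apply: (gradient_continuous _ _ _ _ g2); split=> //; exact: openT.
exact: (cvg_comp _ _ zc (prox_continuous _ _ _ rNoo r_closed rho0 r_wc mu0 mu_rho _ _
  critical_subdifferential _)).
Qed.

Lemma prox_grad_subdifferential x :
  subdifferential r (S x) (mu^-1 *: (x - mu *: gradient g x - S x)).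
Proof.
apply: (prox_argmin_subdifferential _ _ rNoo mu0 _ _ critical_subdifferential).
exact: (proxP _ _ _ rNoo r_closed rho0 r_wc mu0 mu_rho _ _ critical_subdifferential).
Qed.

End ProximalGradientMap.

(** The product of multiplier and Jacobian is differenced as [(ly - lx) Jy + lx (Jy - Jx)]; the
    second term is a difference of gradients of a constraint combination with frozen multiplier, so
    it has an exact slope [QK]. *)
Lemma kkt_difference {R : realType} {d m : nat} {mu : R}
    {y x sy sx Fy Fx gy gx Gy Gx : 'rV[R]_d} {ly lx : 'rV[R]_m} {Jy Jx : 'M[R]_(m, d)}
    {QF Qg QK Qx : 'M[R]_d} :
  sy + mu *: (Fy - gy) + mu *: (ly *m Jy) = y - mu *: Gy ->
  sx + mu *: (Fx - gx) + mu *: (lx *m Jx) = x - mu *: Gx ->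
  Fy = Fx + (sy - sx) *m QF -> gy = gx + (sy - sx) *m Qg ->
  lx *m Jy = lx *m Jx + (sy - sx) *m QK -> Gy = Gx + (y - x) *m Qx ->
  (sy - sx) *m (1%:M + mu *: (QF - Qg + QK)) + (ly - lx) *m (mu *: Jy) =
  (y - x) *m (1%:M - mu *: Qx).
Proof.
move=> Ey Ex EF Eg EK Ex'.
rewrite [(ly - lx) *m _]mulmxBl !(mulmxDr, mulmxN, mulmx1) -!scalemxAr !(mulmxDr, mulmxN).
move: (ly *m Jy) (lx *m Jy) (lx *m Jx) Ey Ex EK => p1 p2 p3 Ey Ex EK.
move: ((sy - sx) *m QF) ((sy - sx) *m Qg) ((sy - sx) *m QK) ((y - x) *m Qx) EF Eg EK Ex'
  => p4 p5 p6 p7 EF Eg EK Ex'.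
rewrite EF Eg Ex' in Ey; rewrite EK.
apply/rowP => j; have := congr1 (fun w : 'rV[R]_d => w 0 j) Ey.
have := congr1 (fun w : 'rV[R]_d => w 0 j) Ex.
rewrite !mxE; lra.
Qed.

(* [S] is the proximal-gradient map, of which only the three properties [Sa], [S_cont]
   and [S_sub] matter. *)
Section ActiveManifold.
Context {R : realType} {d m : nat}.
Variables (g : 'rV[R]_d -> R) (r : 'rV[R]_d -> \bar R) (rho mu : R).
Hypotheses (g2 : Cp_on 2 setT g).
Hypotheses (rNoo : forall x, r x != -oo%E).
Hypotheses (rho0 : 0 < rho) (r_wc : weakly_convex rho r).
Hypotheses (mu0 : 0 < mu) (mu_rho : mu * rho < 1).
Let f x := ((g x)%:E + r x)%E.
Variables (a : 'rV[R]_d) (S : 'rV[R]_d -> 'rV[R]_d).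
Hypotheses (sub_a : subdifferential r a (- gradient g a)) (Sa : S a = a).
Hypothesis S_cont : forall x, S y @[y --> x] --> S x.
Hypothesis S_sub : forall x,
  subdifferential r (S x) (mu^-1 *: (x - mu *: gradient g x - S x)).
Variables (M W : set 'rV[R]_d).
Variables (F : 'rV[R]_d -> R) (G : 'rV[R]_d -> 'rV[R]_m) (c : R).
Hypotheses (aW : open_nbhs a W) (Ma : M a).
Hypotheses (G2 : Cp_on 2 setT G) (Jfull : row_full ('J G a)) (F2 : Cp_on 2 W F).
Hypotheses (MG : forall x, W x -> (M x <-> G x = 0)).
Hypotheses (fF : forall x, W x -> M x -> f x = (F x)%:E).
Hypotheses (c0 : 0 < c).
Hypothesis sharp : forall x v, W x -> ~ M x -> subdifferential f x v -> c <= enorm v.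
Implicit Types (x y v s u : 'rV[R]_d) (l : 'rV[R]_m).

Let dg x : differentiable g x. Proof. by case: g2 => + _; apply. Qed.
Let dG x : differentiable G x. Proof. by case: G2 => + _; apply. Qed.
Let G1 : Cp_on 1 setT G.
Proof.
case: G2 => dG' DG; split=> // v; case: (DG v) => dDG _ x _.
exact: differentiable_continuous (dDG x I).
Qed.
Let setT_nbhs x : open_nbhs x [set: 'rV[R]_d]. Proof. by split=> //; exact: openT. Qed.
Let W_nbhs x : W x -> open_nbhs x W. Proof. by case: aW. Qed.
Let Wa : W a. Proof. by case: aW. Qed.
Let Ga : G a = 0. Proof. exact/MG. Qed.

Let v x := mu^-1 *: (x - mu *: gradient g x - S x).

Let v_cont x : v y @[y --> x] --> v x.
Proof.
apply: (@cvgZl_tmp _ _ _ (nbhs x)); apply: (@cvgB _ _ _ (nbhs x)); last exact: S_cont.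
apply: (@cvgB _ _ _ (nbhs x) _ id); first exact: cvg_id.
by apply: (@cvgZl_tmp _ _ _ (nbhs x)); exact: (gradient_continuous _ _ _ (setT_nbhs x) g2).
Qed.

Let va : v a = - gradient g a.
Proof. by rewrite /v Sa addrAC subrr add0r scalerN scalerA mulVf ?scale1r ?gt_eqF. Qed.

(* [v x + gradient g (S x)] is a subgradient of [f] at [S x] that vanishes at [a], so
   sharpness forces [S x] into [M]. *)
Lemma prox_grad_identifies :
  \forall x \near a, [/\ W (S x), G (S x) = 0 & row_full ('J G (S x))].
Proof.
have Sc := S_cont a; rewrite Sa in Sc.
have SW : \forall x \near a, W (S x) by apply: Sc; exact: open_nbhs_nbhs.
have SJ : \forall x \near a, row_full ('J G (S x)).
  have Jc : ('J G (S x))^T @[x --> a] --> ('J G a)^T.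
    apply: (cvg_trmx (F := nbhs a)).
    exact: (cvg_comp _ _ Sc (jacobian_continuous G a G1)).
  have Jf : row_free ('J G a)^T by rewrite /row_free mxrank_tr.
  apply: filterS (near_row_free (F := nbhs a) _ _ Jc Jf) => x.
  by rewrite /row_free mxrank_tr.
have wc : v x + gradient g (S x) @[x --> a] --> (0 : 'rV[R]_d).
  rewrite [X in _ --> X](_ : _ = v a + gradient g a); last by rewrite va addNr.
  apply: (@cvgD _ _ _ (nbhs a)); first exact: v_cont.
  exact: (cvg_comp _ _ Sc (gradient_continuous _ _ _ (setT_nbhs a) g2)).
have c1 : 0 < c / d.+2%:R by rewrite divr_gt0.
move/(cvgr0Pnorm_le (F := nbhs a)): wc => /(_ _ c1) wc.
near=> x.
have Wx : W (S x) by near: x.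
split; [exact: Wx | | near: x; exact: SJ].
apply/(MG _ Wx); apply: contrapT => Mx.
have := sharp _ _ Wx Mx (subdifferential_add r g _ _ (dg _) (S_sub x)).
have le1 : `|v x + gradient g (S x)| <= c / d.+2%:R by near: x.
apply/negP; rewrite -ltNge (le_lt_trans (enorm_le_norm _)) //.
rewrite (le_lt_trans (ler_wpM2l (ler0n _ _) le1)) //.
by rewrite mulrCA gtr_pMr // ltr_pdivrMr // mul1r ltr_nat.
Unshelve. all: by end_near. Qed.

Let rE x : W x -> G x = 0 -> r x = (F x - g x)%:E.
Proof.
move=> Wx /(MG _ Wx) Mx; have := fF _ Wx Mx; rewrite /f; have := rNoo x.
by case: (r x) => [b| |] //= _ [<-]; rewrite addrAC subrr add0r.
Qed.

(** On the manifold [r] equals [F - g]. Dividing its global subgradient inequality by [t] at points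
    [y + t u'] of the manifold with [u'] near a tangent [u] gives one inequality in the limit; [- u]
    gives the opposite one. *)
Lemma kkt y w : W y -> G y = 0 -> row_full ('J G y) -> subdifferential r y w ->
  (gradient F y - gradient g y - w <= ('J G y)^T)%MS.
Proof.
move=> Wy Gy Jy wr; apply: orthogonal_ker => s sJ.
have [qF [qFc _ FE]] := gradient_slope _ _ (F2.1 _ Wy).
have [qg [qgc _ gE]] := gradient_slope _ _ (dg y).
have half u : u *m 'J G y = 0 -> 0 <= dot u (gradient F y - gradient g y - w).
  move=> uJ; pose p (z : R * 'rV[R]_d) := y + z.1 *: z.2.
  have pc : p z @[z --> filter_prod (0 : R)^'+ (nbhs u)] --> y by exact: cvg_ray.
  have lim : dot z.2 (qF (p z) - qg (p z) - w) + rho / 2 * (z.1 * dot z.2 z.2)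
      @[z --> filter_prod (0 : R)^'+ (nbhs u)] -->
      dot u (gradient F y - gradient g y - w) + rho / 2 * (0 * dot u u).
    apply: cvgD.
      apply: cvg_dot; first exact: cvg_snd.
      apply: cvgB; last exact: cvg_cst.
      by apply: cvgB; [exact: cvg_comp pc qFc|exact: cvg_comp pc qgc].
    apply: cvgM; first exact: cvg_cst.
    apply: cvgM; first exact: cvg_ray_time.
    by apply: cvg_dot; exact: cvg_snd.
  suff : 0 <= dot u (gradient F y - gradient g y - w) + rho / 2 * (0 * dot u u) by lra.
  apply: (cvg_frequently_ge0 _ _ lim) => V FV.
  have FVW : filter_prod (0 : R)^'+ (nbhs u) (V `&` p @^-1` W `&` [set z | 0 < z.1]).
    apply: filterI; last exact: ray_time_gt0.
    by apply: filterI => //; apply: pc; exact: open_nbhs_nbhs (W_nbhs _ Wy).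
  have [z [[Vz Wz] z0] Gz] :=
    tangent_realizable _ _ _ dG (jacobian_continuous _ _ G1) Jy Gy uJ _ FVW.
  exists z => //; rewrite -(pmulr_rge0 _ z0).
  have := weakly_convex_subgradient _ _ _ _ rho0 r_wc rNoo wr (p z).
  rewrite (rE _ Wz Gz) (rE _ Wy Gy) lee_fin (FE (p z)) (gE (p z)).
  rewrite [p z - y]addrAC subrr add0r !dotZl !dotZr.
  rewrite !dotBr [dot w _]dotC; lra.
apply/eqP; rewrite dotC eq_le half // andbT -oppr_ge0 -dotNl half //.
by rewrite mulNmx sJ oppr0.
Qed.

Let good x := [/\ W (S x), G (S x) = 0 & row_full ('J G (S x))].
Let residual x := gradient F (S x) - gradient g (S x) - v x.
(** The multiplier. At good points the transposed Jacobian is row free, so [lamE] determines it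
    uniquely, and its continuity is deduced from that equation. *)
Let lam x : 'rV[R]_m := - (residual x *m pinvmx ('J G (S x))^T).

Let lamE x : good x -> lam x *m ('J G (S x))^T = - residual x.
Proof. by move=> [Wx Gx Jx]; rewrite /lam mulNmx mulmxKpV // kkt. Qed.

Let residual_cont x : W (S x) -> residual y @[y --> x] --> residual x.
Proof.
move=> Wx; apply: (@cvgB _ _ _ (nbhs x)); last exact: v_cont.
have Sc := S_cont x.
apply: (@cvgB _ _ _ (nbhs x)).
  exact: (cvg_comp _ _ Sc (gradient_continuous _ _ _ (W_nbhs _ Wx) F2)).
exact: (cvg_comp _ _ Sc (gradient_continuous _ _ _ (setT_nbhs _) g2)).
Qed.

Let JS_cont x : 'J G (S y) @[y --> x] --> 'J G (S x).
Proof. exact: (cvg_comp _ _ (S_cont x) (jacobian_continuous G _ G1)). Qed.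

Let lam_cont x : (\forall y \near x, good y) -> lam y @[y --> x] --> lam x.
Proof.
move=> goodx; have gx : good x := nbhs_singleton goodx.
have [Wx Gx Jx] := gx.
have Jf : row_free ('J G (S x))^T by rewrite /row_free mxrank_tr.
apply: (cvg_left_division (F := nbhs x) _ _ (cvg_trmx (F := nbhs x) (JS_cont x)) Jf _
  (fun y => - residual y)).
  by apply: filterS goodx => y; exact: lamE.
by rewrite lamE //; apply: (@cvgN _ _ _ (nbhs x)); exact: residual_cont.
Qed.

Let good_a : good a.
Proof. by rewrite /good Sa. Qed.

Let K l x := dot l (G x).
Let K2 l : Cp_on 2 setT (K l). Proof. exact: Cp_on_dot. Qed.

(* On [M] the constraint combination [K (lam a)] vanishes, and adding it to [F] cancels the
   first-order term. *)
Lemma lagrangian_taylor : exists Q : 'rV[R]_d -> 'M[R]_d,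
  Q x @[x --> a] --> 2^-1 *: (hessian F a + hessian (K (lam a)) a) /\
  \forall x \near a, G x = 0 -> F x = F a + dot ((x - a) *m Q x) (x - a).
Proof.
have [QF [QFc FE]] := taylor2_slope _ _ _ aW F2.
have [QK [QKc KE]] := taylor2_slope _ _ _ (setT_nbhs a) (K2 (lam a)).
exists (fun x => QF x + QK x); split.
  by rewrite [X in _ --> X]scalerDr; exact: (@cvgD _ _ _ (nbhs a) _ QF QK _ _ QFc QKc).
have grad0 : gradient F a + gradient (K (lam a)) a = 0.
  have := lamE a good_a; rewrite /residual va Sa opprK subrK => lamJ.
  have -> : gradient (K (lam a)) a = lam a *m ('J G a)^T by exact: gradient_dot.
  by rewrite lamJ subrr.
near=> x => Gx.
have Fx : F x = F a + dot (x - a) (gradient F a) + dot ((x - a) *m QF x) (x - a).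
  by near: x; exact: FE.
have Kx : K (lam a) x = K (lam a) a + dot (x - a) (gradient (K (lam a)) a) +
    dot ((x - a) *m QK x) (x - a).
  by near: x; exact: KE.
have K0 y : G y = 0 -> K (lam a) y = 0 by move=> Gy; rewrite /K Gy dot0r.
rewrite (K0 _ Gx) (K0 _ Ga) add0r in Kx.
have := congr1 (dot (x - a)) grad0; rewrite dotDr dot0r => grad0x.
by rewrite Fx mulmxDr [dot (_ + _ *m _) _]dotDl; lra.
Unshelve. all: by end_near. Qed.

Let HL l y : 'M[R]_d := hessian F y - hessian g y + hessian (K l) y.

Let HL_sym l : (HL l a)^T = HL l a.
Proof.
rewrite /HL !linearD /= linearN /=.
congr (_ - _ + _); first exact: (hessian_sym _ _ _ aW F2).
  exact: (hessian_sym _ _ _ (setT_nbhs a) g2).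
exact: (hessian_sym _ _ _ (setT_nbhs a) (K2 l)).
Qed.

(** The global subgradient inequality of [r] at [a] is divided by [t^2] at points [a + t s'] of the
    manifold. The first-order term of [F] is removed by the multiplier, that of [g] by the
    subgradient [- gradient g a]. *)
Lemma lagrangian_second_order s :
  s *m 'J G a = 0 -> - rho * dot s s <= dot (s *m HL (lam a) a) s.
Proof.
move=> sJ; have [Q [Qc FE]] := lagrangian_taylor.
have [Qg [Qgc gE]] := taylor2_slope _ _ _ (setT_nbhs a) g2.
pose p (z : R * 'rV[R]_d) := a + z.1 *: z.2.
have pc : p z @[z --> filter_prod (0 : R)^'+ (nbhs s)] --> a by exact: cvg_ray.
have lim : dot (z.2 *m (Q (p z) - Qg (p z))) z.2 + rho / 2 * dot z.2 z.2
    @[z --> filter_prod (0 : R)^'+ (nbhs s)] -->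
    dot (s *m (2^-1 *: (hessian F a + hessian (K (lam a)) a) - 2^-1 *: hessian g a)) s
     + rho / 2 * dot s s.
  apply: cvgD.
    apply: cvg_dot; last exact: cvg_snd.
    apply: cvg_mulmx; first exact: cvg_snd.
    by apply: cvgB; [exact: cvg_comp pc Qc|exact: cvg_comp pc Qgc].
  apply: cvgM; first exact: cvg_cst.
  by apply: cvg_dot; exact: cvg_snd.
have := cvg_frequently_ge0 _ _ lim.
rewrite -scalerBr -scalemxAr dotZl addrAC -/(HL (lam a) a) => lim0.
suff : 0 <= 2^-1 * dot (s *m HL (lam a) a) s + rho / 2 * dot s s by lra.
apply: lim0 => V FV.
have FVW : filter_prod (0 : R)^'+ (nbhs s) (V `&` p @^-1` (W `&`
    [set x | G x = 0 -> F x = F a + dot ((x - a) *m Q x) (x - a)] `&`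
    [set x | g x = g a + dot (x - a) (gradient g a) + dot ((x - a) *m Qg x) (x - a)])
    `&` [set z | 0 < z.1]).
  apply: filterI; last exact: ray_time_gt0.
  apply: filterI => //; apply: pc; apply: filterI => //; apply: filterI => //.
  exact: open_nbhs_nbhs aW.
have [z [[Vz [[Wz Fz] gz]] z0] Gz] :=
  tangent_realizable _ _ _ dG (jacobian_continuous _ _ G1) Jfull Ga sJ _ FVW.
exists z => //; rewrite -(pmulr_rge0 _ z0) -(pmulr_rge0 _ z0).
have := weakly_convex_subgradient _ _ _ _ rho0 r_wc rNoo sub_a (p z).
rewrite (rE _ Wz Gz) (rE _ Wa Ga) lee_fin Fz // gz.
rewrite [p z - a]addrAC subrr add0r -!scalemxAl !dotZl !dotZr mulmxBr dotBl.
by rewrite dotNl [dot (gradient g a) _]dotC; lra.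
Qed.

Let B x : 'M[R]_(d + m) :=
  block_mx (1%:M + mu *: HL (lam x) (S x)) ('J G (S x)) (mu *: ('J G (S x))^T) 0.

Let B_cont x : (\forall y \near x, good y) -> B y @[y --> x] --> B x.
Proof.
move=> goodx; have [Wx _ _] : good x := nbhs_singleton goodx.
have Sc := S_cont x.
apply: (cvg_block_mx (F := nbhs x)).
- apply: (@cvgD _ _ _ (nbhs x) _ (fun=> 1%:M)); first exact: cvg_cst.
  apply: (@cvgZl_tmp _ _ _ (nbhs x)); apply: (@cvgD _ _ _ (nbhs x)).
    apply: (@cvgB _ _ _ (nbhs x)).
      exact: (cvg_comp _ _ Sc (hessian_continuous _ _ _ (W_nbhs _ Wx) F2)).
    exact: (cvg_comp _ _ Sc (hessian_continuous _ _ _ (setT_nbhs _) g2)).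
  exact: (hessian_dot_cvg (F := nbhs x) _ _ _ _ _ G2 (lam_cont _ goodx) Sc).
- exact: JS_cont.
- by apply: (@cvgZl_tmp _ _ _ (nbhs x)); exact: (cvg_trmx (F := nbhs x) (JS_cont x)).
- exact: cvg_cst.
Qed.

(** For a row [(s, n)] in the kernel, [s] is tangent; pairing the first equation with [s] removes
    [n] and leaves [0 >= (1 - mu rho) |s|^2]. Then [n] is killed by the injective transposed
    Jacobian. *)
Let B_free_a : row_free (B a).
Proof.
have Jf : row_free ('J G a)^T by rewrite /row_free mxrank_tr.
apply: inj_row_free => z; rewrite -[z]hsubmxK /B Sa.
move: (lsubmx z) (rsubmx z) => s n; rewrite mul_row_block mulmx0 addr0 -(row_mx0 _ 1).
move=> /eq_row_mx [sn sJ].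
have s0 : s = 0.
  have := congr1 (fun w => dot w s) sn.
  rewrite dot0l mulmxDr mulmx1 !dotDl -!scalemxAr !dotZl.
  rewrite [dot (n *m _) s]dot_mulmxl trmxK sJ dot0r mulr0 addr0 => s0.
  have := lagrangian_second_order _ sJ; rewrite -(ler_pM2l mu0) => le1.
  apply: dot_eq0; apply/eqP; rewrite eq_le dot_ge0 andbT.
  have k0 : 0 < 1 - mu * rho by rewrite subr_gt0.
  by rewrite -(pmulr_rle0 _ k0); lra.
move: sn; rewrite s0 mul0mx add0r -scalemxAr => /eqP.
rewrite scaler_eq0 gt_eqF //= mulmx_free_eq0 // => /eqP ->.
by rewrite row_mx0.
Qed.

Let ok x := good x /\ row_free (B x).

Let near_ok : \forall x \near a, ok x.
Proof.
have := near_row_free (F := nbhs a) _ _ (B_cont _ prox_grad_identifies) B_free_a.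
by move=> Bf; near=> x; split; near: x; [exact: prox_grad_identifies|exact: Bf].
Unshelve. all: by end_near. Qed.

(** The upper left block of the inverse of [B x]: the response of the point, without the multiplier,
    to the right-hand side of the system. *)
Let X x : 'M[R]_d := lsubmx (row_mx 1%:M 0 *m invmx (B x)).

Let kkt_eq y : good y ->
  S y + mu *: (gradient F (S y) - gradient g (S y)) + mu *: (lam y *m ('J G (S y))^T)
  = y - mu *: gradient g y.
Proof.
move=> gy; rewrite lamE // /residual /v.
move: (S y) (gradient F (S y)) (gradient g (S y)) (gradient g y) => p1 p2 p3 p4.
apply/rowP => j; rewrite !mxE; field; rewrite gt_eqF //.
Qed.

(** Subtracting the systems at [y] and [x] gives an exact linear equation for the increments of [S]
    and [lam], with a matrix [A y] that tends to [B x]; solving it exhibits a convergent slope of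
    [S]. *)
Let prox_grad_diff x : (\forall y \near x, good y) -> row_free (B x) ->
  differentiable S x /\ 'J S x = (1%:M - mu *: hessian g x) *m X x.
Proof.
move=> goodx Bfree; have gx : good x := nbhs_singleton goodx.
have [Wx Gx _] := gx; have Sc := S_cont x.
have [QF [QFc _ FE]] := gradient_matrix_slope _ _ _ (W_nbhs _ Wx) F2.
have [Qg [Qgc _ gE]] := gradient_matrix_slope _ _ _ (setT_nbhs (S x)) g2.
have [Qx [Qxc _ xE]] := gradient_matrix_slope _ _ _ (setT_nbhs x) g2.
have [QK [QKc _ KE]] := gradient_matrix_slope _ _ _ (setT_nbhs (S x)) (K2 (lam x)).
have [QG [QGc GE]] := jacobian_slope _ _ (dG (S x)).
pose A y : 'M[R]_(d + m) :=
  block_mx (1%:M + mu *: (QF (S y) - Qg (S y) + QK (S y))) (QG (S y))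
    (mu *: ('J G (S y))^T) 0.
have Ac : A y @[y --> x] --> B x.
  apply: (cvg_block_mx (F := nbhs x)).
  - apply: (@cvgD _ _ _ (nbhs x) _ (fun=> 1%:M)); first exact: cvg_cst.
    apply: (@cvgZl_tmp _ _ _ (nbhs x)); apply: (@cvgD _ _ _ (nbhs x)).
      by apply: (@cvgB _ _ _ (nbhs x)); [exact: (cvg_comp _ _ Sc QFc)|exact: (cvg_comp _ _ Sc Qgc)].
    exact: (cvg_comp _ _ Sc QKc).
  - exact: (cvg_comp _ _ Sc QGc).
  - by apply: (@cvgZl_tmp _ _ _ (nbhs x)); exact: (cvg_trmx (F := nbhs x) (JS_cont x)).
  - exact: cvg_cst.
have Afree := near_row_free (F := nbhs x) _ _ Ac Bfree.
(* The first block of rows of the inverse is the solution of [L *m A y = row_mx 1%:M 0]. *)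
have Xc : row_mx 1%:M 0 *m invmx (A y) @[y --> x] --> row_mx 1%:M 0 *m invmx (B x).
  apply: (cvg_left_division (F := nbhs x) _ _ Ac Bfree _ (fun=> row_mx 1%:M 0)).
    by near=> y; rewrite mulmxKV // -row_free_unit; near: y; exact: Afree.
  by rewrite mulmxKV -?row_free_unit //; exact: cvg_cst.
apply: (slope_diff _ _ (fun y => (1%:M - mu *: Qx y) *m lsubmx (row_mx 1%:M 0 *m invmx (A y)))).
- near=> y.
  have gy : good y by near: y.
  have Ay : A y \in unitmx by rewrite -row_free_unit; near: y; exact: Afree.
  have [Wy Gy _] := gy.
  have zero_slope (p q w : 'rV[R]_m) : p = q + w -> p = 0 -> q = 0 -> w = 0.
    by move=> -> + q0; rewrite q0 add0r.
  have sys : row_mx (S y - S x) (lam y - lam x) *m A y =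
      ((y - x) *m (1%:M - mu *: Qx y)) *m row_mx 1%:M 0.
    rewrite mul_row_block mul_mx_row !mulmx0 addr0 mulmx1; congr row_mx; last first.
      exact: (zero_slope _ _ _ (GE (S y)) Gy Gx).
    have Ey := kkt_eq y gy; have Ex := kkt_eq x gx.
    have KEy := KE (S y); rewrite !gradient_dot // in KEy.
    exact: kkt_difference Ey Ex (FE (S y)) (gE (S y)) KEy (xE y).
  rewrite mulmxA -[LHS](subrK (S x)) addrC; congr (_ + _).
  rewrite -[LHS](row_mxKl _ (lam y - lam x)) -[row_mx _ _](mulmxK Ay) sys.
  by rewrite -[_ *m row_mx _ _ *m _]mulmxA mulmx_lsub.
- apply: (cvg_mulmx (F := nbhs x)).
    apply: (@cvgB _ _ _ (nbhs x) _ (fun=> 1%:M)); first exact: cvg_cst.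
    exact: (@cvgZl_tmp _ _ _ (nbhs x) _ mu Qx _ Qxc).
  exact: (cvg_lsubmx (F := nbhs x) Xc).
Unshelve. all: by end_near. Qed.

Lemma prox_grad_C1 : exists2 U, open_nbhs a U & Cp_on 1 U S.
Proof.
(* On the interior [ok] holds in a neighborhood of each point, as the derivative formula and the
   continuity of the multiplier require. *)
exists [set x | ok x]°; first by split; [exact: open_interior|exact: near_ok].
have near_good x : [set x | ok x]° x -> \forall y \near x, good y.
  by apply: filterS => y [].
have diffS x : [set x | ok x]° x -> differentiable S x /\
    'J S x = (1%:M - mu *: hessian g x) *m X x.
  move=> okx; apply: prox_grad_diff; first exact: near_good.
  by have [] := nbhs_singleton okx.
split=> [x /diffS []//|w x okx].
have Bfree : row_free (B x) by have [] := nbhs_singleton okx.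
have Bnear : \forall y \near x, row_free (B y) by apply: filterS okx => y [].
have Bc := B_cont _ (near_good _ okx).
have Xc : row_mx 1%:M 0 *m invmx (B y) @[y --> x] --> row_mx 1%:M 0 *m invmx (B x).
  apply: (cvg_left_division (F := nbhs x) _ _ Bc Bfree _ (fun=> row_mx 1%:M 0)).
    by near=> y; rewrite mulmxKV // -row_free_unit; near: y; exact: Bnear.
  by rewrite mulmxKV -?row_free_unit //; exact: cvg_cst.
have lim : w *m ((1%:M - mu *: hessian g y) *m X y) @[y --> x] -->
    w *m ((1%:M - mu *: hessian g x) *m X x).
  apply: (cvg_mulmx (F := nbhs x)); first exact: cvg_cst.
  apply: (cvg_mulmx (F := nbhs x)).
    apply: (@cvgB _ _ _ (nbhs x) _ (fun=> 1%:M)); first exact: cvg_cst.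
    apply: (@cvgZl_tmp _ _ _ (nbhs x)).
    exact: (hessian_continuous _ _ _ (setT_nbhs _) g2).
  exact: (cvg_lsubmx (F := nbhs x) Xc).
have DE y : [set x | ok x]° y -> 'D_w S y = w *m ((1%:M - mu *: hessian g y) *m X y).
  by move=> /diffS [dS <-]; exact: deriveEjacobian.
suff : 'D_w S y @[y --> x] --> 'D_w S x by [].
rewrite (DE _ okx); apply: cvg_trans lim; apply: (@near_eq_cvg _ _ (nbhs x)).
have Unear : \forall y \near x, [set x | ok x]° y.
  by apply: open_nbhs_nbhs; split=> //; exact: open_interior.
by near=> y; rewrite DE //; near: y; exact: Unear.
Unshelve. all: by end_near. Qed.

Lemma saddle_eigenvalue u : u *m 'J G a = 0 ->
  dot (u *m (hessian F a + hessian (K (lam a)) a)) u < 0 ->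
  exists2 l, 1 < l & eigenvalue ('J S a) l.
Proof.
move=> uJ uH; have [_ JS] := prox_grad_diff a prox_grad_identifies B_free_a.
set H := HL (lam a) a; set E := 1%:M + mu *: H; set D := 1%:M - mu *: hessian g a.
have Epos s : s *m 'J G a = 0 -> s != 0 -> 0 < dot (s *m E) s.
  move=> sJ s0; have := lagrangian_second_order _ sJ; rewrite -(ler_pM2l mu0) => le1.
  rewrite /E mulmxDr mulmx1 dotDl -scalemxAr dotZl.
  have : 0 < (1 - mu * rho) * dot s s.
    rewrite mulr_gt0 ?subr_gt0 // lt_neqAle dot_ge0 andbT eq_sym.
    by apply: contra s0 => /eqP /dot_eq0 ->.
  lra.
have [|||l [w [l1 w0 wJ wED]]] := generalized_eigenvector_gt1 E D ('J G a) u _ _ Epos uJ.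
- by rewrite /E linearD /= trmx1 linearZ /= /H HL_sym.
- rewrite /D linearB /= trmx1 linearZ /=.
  by congr (_ - _ *: _); exact: (hessian_sym _ _ _ (setT_nbhs a) g2).
- have -> : dot (u *m E) u = dot u u + mu * dot (u *m H) u.
    by rewrite /E mulmxDr mulmx1 dotDl -scalemxAr dotZl.
  have -> : dot (u *m D) u = dot u u - mu * dot (u *m hessian g a) u.
    by rewrite /D mulmxBr mulmx1 dotBl -scalemxAr dotZl.
  have HE : hessian F a + hessian (K (lam a)) a = H + hessian g a.
    rewrite /H /HL; move: (hessian F a) (hessian g a) (hessian _ a) => p1 p2 p3.
    by rewrite addrAC subrK.
  (* The form of [E] minus that of [D] is [mu] times this sum, so negative curvature puts [D] above
     [E] at [u]. *)
  have : dot (u *m H) u + dot (u *m hessian g a) u < 0.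
    by rewrite -dotDl -mulmxDr -HE.
  move: (dot (u *m H) u) (dot (u *m hessian g a) u) => p1 p2.
  by rewrite -(pmulr_rlt0 _ mu0) mulrDr; lra.
exists l => //; apply/eigenvalueP; exists w => //.
pose z := w *m D *m (row_mx 1%:M 0 *m invmx (B a)).
have zE : w *m 'J S a = lsubmx z by rewrite JS mulmxA /X mulmx_lsub.
have zB : z *m B a = row_mx (w *m D) 0.
  by rewrite /z -mulmxA mulmxKV -?row_free_unit // mul_mx_row mulmx1 mulmx0.
move: zB; rewrite -[z]hsubmxK -zE /B Sa mul_row_block mulmx0 addr0.
move: (rsubmx z) => n /eq_row_mx [sE sJ].
set s := w *m 'J S a in sE sJ *.
(* Both [s = w *m 'J S a] and [l *: w] represent, through [E] on [ker J], the functional given by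
   [w *m D]; their tangent difference has zero [E]-energy and so vanishes. *)
have eJ : (s - l *: w) *m 'J G a = 0 by rewrite mulmxBl sJ -scalemxAl wJ scaler0 subr0.
apply/eqP; rewrite -subr_eq0; apply: contraT => /(Epos _ eJ); rewrite mulmxBl dotBl.
have -> : s *m E = w *m D - n *m (mu *: ('J G a)^T) by rewrite -sE addrK.
have -> : dot (w *m D - n *m (mu *: ('J G a)^T)) (s - l *: w) = dot (w *m D) (s - l *: w).
  by rewrite dotBl -scalemxAr dotZl [dot (n *m _) _]dot_mulmxl trmxK eJ dot0r mulr0 subr0.
by rewrite wED // -scalemxAl dotZl subrr ltxx.
Qed.

(** A finite negative subderivative is approached along arcs on [M]: their constraint equation, to
    first order, makes [u] tangent, and the Lagrangian expansion, to second order, makes the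
    curvature negative. *)
Lemma saddle_direction u :
  second_variation (restrict_fun f M) a u < 0 ->
  u *m 'J G a = 0 /\ dot (u *m (hessian F a + hessian (K (lam a)) a)) u < 0.
Proof.
set C := [set b | exists w, parabolic_subderivative (restrict_fun f M) a u w = b%:E].
move=> Cneg; have [b [w bw] b0] : exists2 b, C b & b < 0.
  have [Cex|Cnex] := pselect (exists b, C b).
    by exists (get C) => //; exact: getPex.
  (* On an empty set [get] returns the default value [0], which is not negative. *)
  move: Cneg; rewrite /second_variation -/C xgetPN ?ltxx // => b Cb.
  by apply: Cnex; exists b.
have fa : f a = (F a)%:E by exact: fF.
have ra : restrict_fun f M a = (F a)%:E.
  by rewrite /restrict_fun mem_set // adde0 fa.
(* The parabolic arc [a + t u + t^2 / 2 w'] is read as [a + t p] with [p] tending to [u]. *)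
pose p (z : R * 'rV[R]_d) := u + (z.1 / 2) *: z.2.
pose q z := a + z.1 *: p z.
have pc : p z @[z --> filter_prod (0 : R)^'+ (nbhs w)] --> u.
  rewrite [X in _ --> X](_ : u = u + (0 / 2) *: w); last by rewrite mul0r scale0r addr0.
  apply: cvgD; first exact: cvg_cst.
  apply: cvgZ; last exact: cvg_snd.
  by apply: cvgM; [exact: cvg_ray_time|exact: cvg_cst].
have qc : q z @[z --> filter_prod (0 : R)^'+ (nbhs w)] --> a.
  rewrite [X in _ --> X](_ : a = a + 0 *: u); last by rewrite scale0r addr0.
  apply: cvgD; first exact: cvg_cst.
  by apply: cvgZ; [exact: cvg_ray_time|exact: pc].
have freq V : filter_prod (0 : R)^'+ (nbhs w) V ->
    exists2 z, V z & [/\ 0 < z.1, G (q z) = 0 & F (q z) - F a < b / 2 * (z.1 ^+ 2 / 2)].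
  move=> FV.
  have FVW : filter_prod (0 : R)^'+ (nbhs w) (V `&` q @^-1` W `&` [set z | 0 < z.1]).
    apply: filterI; last exact: ray_time_gt0.
    by apply: filterI => //; apply: qc; exact: open_nbhs_nbhs aW.
  pose h (z : R * 'rV[R]_d) := ((restrict_fun f M (a + z.1 *: u + (z.1 ^+ 2 / 2) *: z.2)%R
    - restrict_fun f M a) * ((z.1 ^+ 2 / 2)^-1)%:E)%E.
  have inf_lt : (ereal_inf (h @` (V `&` q @^-1` W `&` [set z | (0 < z.1)%R])) < (b / 2)%:E)%E.
    (* The lower limit is [b < b / 2], so every set of the filter contains a quotient below [b / 2];
       such a point lies on [M], off which the quotient is infinite. *)
    apply: (@le_lt_trans _ _ b%:E); last by rewrite lte_fin; move: b0; lra.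
    rewrite -bw /parabolic_subderivative limf_einfE; apply: ereal_sup_ubound.
    by exists (V `&` q @^-1` W `&` [set z | 0 < z.1]).
  have [_ [z [[Vz Wz] z0] <-]] := ereal_inf_lt inf_lt.
  have qE : a + z.1 *: u + (z.1 ^+ 2 / 2) *: z.2 = q z.
    by rewrite /q /p scalerDr scalerA addrA expr2 mulrA.
  have t0 : 0 < z.1 ^+ 2 / 2 by rewrite divr_gt0 // exprn_gt0.
  rewrite /h qE ra /restrict_fun.
  have [Mq|Mq] := boolP (q z \in M).
    move: Mq; rewrite inE => Mq; rewrite adde0 (fF _ Wz Mq) -EFinB -EFinM lte_fin => lt.
    exists z => //; split=> //; first exact/MG.
    by rewrite -ltr_pdivrMr.
  have -> : (f (q z) + +oo = +oo)%E.
    by rewrite /f; have := rNoo (q z); case: (r (q z)).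
  by rewrite addye // gt0_mulye ?lte_fin ?invr_gt0.
have [QG [QGc GE]] := jacobian_slope _ _ (dG a).
have [Q [Qc FE]] := lagrangian_taylor.
split.
  have lim : p z *m QG (q z) @[z --> filter_prod (0 : R)^'+ (nbhs w)] --> u *m 'J G a.
    by apply: cvg_mulmx => //; exact: cvg_comp qc QGc.
  apply: (cvg_frequently_eq0 _ _ lim) => V /freq [z Vz [z0 Gq _]]; exists z => //.
  have := GE (q z); rewrite Gq Ga add0r /q addrAC subrr add0r -scalemxAl => /esym/eqP.
  by rewrite scaler_eq0 gt_eqF //= => /eqP.
have lim : b / 4 - dot (p z *m Q (q z)) (p z) @[z --> filter_prod (0 : R)^'+ (nbhs w)] -->
    b / 4 - dot (u *m (2^-1 *: (hessian F a + hessian (K (lam a)) a))) u.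
  apply: cvgB; first exact: cvg_cst.
  apply: cvg_dot => //; apply: cvg_mulmx => //; exact: cvg_comp qc Qc.
have := cvg_frequently_ge0 _ _ lim; rewrite -scalemxAr dotZl => ge0.
suff : 0 <= b / 4 - 2^-1 * dot (u *m (hessian F a + hessian (K (lam a)) a)) u.
  by move: b0; lra.
apply: ge0 => V FV.
have [|z [Vz FEz] [z0 Gq ltF]] := freq (V `&` q @^-1`
    [set x | G x = 0 -> F x = F a + dot ((x - a) *m Q x) (x - a)]).
  by apply: filterI => //; exact: qc.
exists z => //; move: ltF; rewrite FEz // {2 4}/q [a + _ - a]addrAC subrr add0r.
rewrite -scalemxAl dotZl dotZr addrAC subrr add0r => ltF.
have z2 : 0 < z.1 ^+ 2 by rewrite exprn_gt0.
rewrite subr_ge0 ltW // -(ltr_pM2l z2); move: ltF; rewrite expr2; lra.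
Qed.

Lemma strict_saddle_eigenvalue u :
  second_variation (restrict_fun f M) a u < 0 ->
  exists2 l, 1 < l & eigenvalue ('J S a) l.
Proof. by case/saddle_direction; exact: saddle_eigenvalue. Qed.

End ActiveManifold.

Theorem theorem4p1 (R : realType) (d : nat)
    (g : 'rV[R]_d -> R) (beta : R)
    (r : 'rV[R]_d -> \bar R) (rho : R)
    (f := (fun x => (g x)%:E + r x)%E : 'rV[R]_d -> \bar R)
    (xbar : 'rV[R]_d) (M : set 'rV[R]_d) (mu : R)
    (S := (fun x => prox mu r (x - mu *: gradient g x)) : 'rV[R]_d -> 'rV[R]_d) :
  Cp_on 2 setT g ->
  (forall x y, enorm (gradient g x - gradient g y) <= beta * enorm (x - y)) ->
  (forall x, r x != -oo%E) ->
  closed_fun r ->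
  0 < rho -> weakly_convex rho r ->
  bounded_below f ->
  critical f xbar ->
  active_manifold 2 f M xbar ->
  0 < mu < rho^-1 ->
  (exists2 U, open_nbhs xbar U & Cp_on 1 U S) /\
  (strict_saddle f xbar -> exists2 a : R, 1 < a & eigenvalue ('J S xbar) a).
Proof.
move=> g2 _ rNoo r_closed rho0 r_wc _ x_crit M_active /andP[mu0 mu_lt].
have mu_rho : mu * rho < 1.
  by rewrite -(ltr_pM2r (_ : 0 < rho^-1)) ?invr_gt0 // mulfK ?gt_eqF ?mul1r.
have sub_x := critical_subdifferential _ _ g2 _ x_crit.
have Sx := prox_grad_fixed _ _ _ _ g2 rNoo r_closed rho0 r_wc mu0 mu_rho _ x_crit.
have S_cont := prox_grad_continuous _ _ _ _ g2 rNoo r_closed rho0 r_wc mu0 mu_rho _ x_crit.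
have S_sub := prox_grad_subdifferential _ _ _ _ g2 rNoo r_closed rho0 r_wc mu0 mu_rho _ x_crit.
split.
  have [m [G [F [W [aW Ma [G2 Jfull] F2 [MG fF [c c0 sharp]]]]]]] :=
    active_manifold_local _ _ _ M_active.
  exact: (prox_grad_C1 g r rho mu g2 rNoo rho0 r_wc mu0 mu_rho xbar S sub_x Sx S_cont S_sub
    M W F G c aW Ma G2 Jfull F2 MG fF c0 sharp).
(* The strict saddle comes with its own active manifold [N], so the local data are built anew for
   it. *)
move=> [_ [N N_active [u _ u_neg]]].
have [m [G [F [W [aW Ma [G2 Jfull] F2 [MG fF [c c0 sharp]]]]]]] :=
  active_manifold_local _ _ _ N_active.
exact: (strict_saddle_eigenvalue g r rho mu g2 rNoo rho0 r_wc mu0 mu_rho xbar S sub_x Sx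
  S_cont S_sub N W F G c aW Ma G2 Jfull F2 MG fF c0 sharp u u_neg).
Qed.
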